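(* Let $\mathbf{U}$ and $\mathbf{U}^+$ be universes with $\mathbf{U} \in \mathbf{U}^+$, and let $\kappa$ and $\lambda$ be regular cardinals in $\mathbf{U}$ with $\kappa \le \lambda$. Suppose that $\mathcal{C}$ is a locally $\kappa$-presentable $\mathbf{U}$-category, $\mathcal{D}$ is a locally $\lambda$-presentable $\mathbf{U}$-category, $\mathcal{C}^+$ is a locally $\kappa$-presentable $\mathbf{U}^+$-category, and $\mathcal{D}^+$ is a locally $\lambda$-presentable $\mathbf{U}^+$-category. Let $i : \mathcal{C} \to \mathcal{C}^+$ be a $(\kappa, \mathbf{U}, \mathbf{U}^+)$-accessible extension and let $j : \mathcal{D} \to \mathcal{D}^+$ be a fully faithful functor. (i) Let $G : \mathcal{D} \to \mathcal{C}$ be a $(\lambda, \mathbf{U})$-accessible functor and $G^+ : \mathcal{D}^+ \to \mathcal{C}^+$ a $(\lambda, \mathbf{U}^+)$-accessible functor such that $i G = G^+ j$ (strictly). If both $G$ and $G^+$ have left adjoints and $j$ is a $(\lambda, \mathbf{U}, \mathbf{U}^+)$-accessible extension, then this commutative square satisfies the left Beck--Chevalley condition. (ii) Let $F : \mathcal{C} \to \mathcal{D}$ and $F^+ : \mathcal{C}^+ \to \mathcal{D}^+$ be functors such that $j F = F^+ i$ (strictly). If both $F$ and $F^+$ have right adjoints, then this commutative square satisfies the right Beck--Chevalley condition.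
   Context: A pre-universe is a set $\mathbf{U}$ such that: if $x \in y$ and $y \in \mathbf{U}$ then $x \in \mathbf{U}$; if $x, y \in \mathbf{U}$ then $\{x,y\} \in \mathbf{U}$; if $x \in \mathbf{U}$ then the power set of $x$ is in $\mathbf{U}$; if $x \in \mathbf{U}$ and $f : x \to \mathbf{U}$ is a map then $\bigcup_{t \in x} f(t) \in \mathbf{U}$. A universe is a pre-universe containing $\omega$ as a member. All categories are sets (models of the theory of categories inside set theory). A category is $\mathbf{U}$-small if its sets of objects and morphisms are members of $\mathbf{U}$; it is locally $\mathbf{U}$-small if its sets of objects and morphisms are subsets of $\mathbf{U}$ and all its hom-sets are members of $\mathbf{U}$. A $\mathbf{U}$-small diagram is a functor from a $\mathbf{U}$-small category. Let $\kappa$ be a regular cardinal in a universe $\mathbf{U}$. An object $A$ of a category $\mathcal{C}$ is $(\kappa,\mathbf{U})$-compact if $\mathrm{Hom}_{\mathcal{C}}(A,-)$, regarded as a functor to a sufficiently large category of sets, preserves colimits of all $\mathbf{U}$-small $\kappa$-filtered diagrams; $\mathbf{K}_\kappa^{\mathbf{U}}(\mathcal{C})$ denotes the full subcategory of $(\kappa,\mathbf{U})$-compact objects. A $\kappa$-accessible $\mathbf{U}$-category is a locally $\mathbf{U}$-small category $\mathcal{C}$ that has colimits for all $\mathbf{U}$-small $\kappa$-filtered diagrams and for which there is a set $\mathcal{G} \in \mathbf{U}$ of $(\kappa,\mathbf{U})$-compact objects such that every object of $\mathcal{C}$ is a colimit of a $\mathbf{U}$-small $\kappa$-filtered diagram of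 objects in $\mathcal{G}$. A locally $\kappa$-presentable $\mathbf{U}$-category is a $\kappa$-accessible $\mathbf{U}$-category having colimits for all $\mathbf{U}$-small diagrams. A $(\kappa,\mathbf{U})$-accessible functor is a functor whose domain is a $\kappa$-accessible $\mathbf{U}$-category and which preserves colimits of all $\mathbf{U}$-small $\kappa$-filtered diagrams. Let $\mathbf{U}^+$ be a universe with $\mathbf{U} \subseteq \mathbf{U}^+$. A $(\kappa,\mathbf{U},\mathbf{U}^+)$-accessible extension is a $(\kappa,\mathbf{U})$-accessible functor $i : \mathcal{C} \to \mathcal{C}^+$ such that $\mathcal{C}$ is a $\kappa$-accessible $\mathbf{U}$-category, $\mathcal{C}^+$ is a $\kappa$-accessible $\mathbf{U}^+$-category, $i$ sends $(\kappa,\mathbf{U})$-compact objects of $\mathcal{C}$ to $(\kappa,\mathbf{U}^+)$-compact objects of $\mathcal{C}^+$, and the induced functor $\mathbf{K}_\kappa^{\mathbf{U}}(\mathcal{C}) \to \mathbf{K}_\kappa^{\mathbf{U}^+}(\mathcal{C}^+)$ is fully faithful and essentially surjective on objects. Beck--Chevalley conditions. Let $F \dashv G : \mathcal{D} \to \mathcal{C}$ and $F' \dashv G' : \mathcal{D}' \to \mathcal{C}'$ be adjunctions with units $\eta, \eta'$ and counits $\epsilon, \epsilon'$, and let $H : \mathcal{C} \to \mathcal{C}'$, $K : \mathcal{D} \to \mathcal{D}'$ be functors. A square with a natural isomorphism $\alpha : HG \Rightarrow G'K$ satisfies the left Beck--Chevalley condition if its mate $\epsilon' K F \circ F'\alpha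 F \circ F'H\eta : F'H \Rightarrow KF$ is a natural isomorphism. A square with a natural isomorphism $\beta : F'H \Rightarrow KF$ satisfies the right Beck--Chevalley condition if its mate $G'K\epsilon \circ G'\beta G \circ \eta' HG : HG \Rightarrow G'K$ is a natural isomorphism. For strictly commutative squares, $\alpha$ (respectively $\beta$) is the identity. *)

(* Defs.v *)
From Stdlib Require Import FunctionalExtensionality.
From mathcomp Require Import ssreflect ssrfun ssrbool.

Set Implicit Arguments.
Unset Strict Implicit.
Unset Printing Implicit Defensive.

(** * Sets *)

(* The ambient set theory: a model of ZFC whose separation and replacement
   schemes range over all predicates and functions of the metatheory. *)
Record zfc := Zfc {
  carrier :> Type;
  member : carrier -> carrier -> Prop;
  emptyset : carrier;
  upair : carrier -> carrier -> carrier;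
  union : carrier -> carrier;
  powerset : carrier -> carrier;
  sep : carrier -> (carrier -> Prop) -> carrier;
  repl : carrier -> (carrier -> carrier) -> carrier;
  omega : carrier;
  mem_ext : forall x y, (forall z, member z x <-> member z y) -> x = y;
  mem_wf : well_founded member;
  mem_emptyset : forall z, ~ member z emptyset;
  mem_upair : forall x y z, member z (upair x y) <-> z = x \/ z = y;
  mem_union : forall x z,
    member z (union x) <-> exists2 y, member y x & member z y;
  mem_powerset : forall x z,
    member z (powerset x) <-> forall t, member t z -> member t x;
  mem_sep : forall x P z, member z (sep x P) <-> member z x /\ P z;
  mem_repl : forall x f z,
    member z (repl x f) <-> exists2 t, member t x & z = f t;
  omega0 : member emptyset omega;
  omegaS : forall n,
    member n omega -> member (union (upair n (upair n n))) omega;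
  omega_min : forall w,
    member emptyset w ->
    (forall n, member n w -> member (union (upair n (upair n n))) w) ->
    forall n, member n omega -> member n w;
  set_choice : forall x, (forall y, member y x -> y <> emptyset) ->
    exists f : carrier -> carrier, forall y, member y x -> member (f y) y
}.

Arguments omega {_}.

Notation "x ∈ y" := (member x y) (at level 70, no associativity).

Definition subset (S : zfc) (x y : S) : Prop := forall z, z ∈ x -> z ∈ y.

Notation "x ⊆ y" := (subset x y) (at level 70, no associativity).

Definition El (S : zfc) (x : S) : Type := {y : S | y ∈ x}.

Definition pre_universe (S : zfc) (U : S) : Prop :=
  [/\ forall x y : S, x ∈ y -> y ∈ U -> x ∈ U,
      forall x y : S, x ∈ U -> y ∈ U -> upair x y ∈ U,
      forall x : S, x ∈ U -> powerset x ∈ U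
    & forall (x : S) (f : S -> S), x ∈ U -> (forall t, t ∈ x -> f t ∈ U) ->
        union (repl x f) ∈ U].

Definition universe (S : zfc) (U : S) : Prop := pre_universe U /\ omega ∈ U.

Definition equipotent (S : zfc) (x y : S) : Prop :=
  exists f : El x -> El y, bijective f.

Definition transitive_set (S : zfc) (x : S) : Prop :=
  forall y, y ∈ x -> y ⊆ x.

(* Well-ordering by membership is automatic because membership is
   well-founded. *)
Definition ordinal (S : zfc) (x : S) : Prop :=
  transitive_set x /\ forall y, y ∈ x -> transitive_set y.

Definition cardinal (S : zfc) (x : S) : Prop :=
  ordinal x /\ forall y, y ∈ x -> ~ equipotent y x.

Definition regular_cardinal (S : zfc) (kappa : S) : Prop :=
  [/\ cardinal kappa,
      omega ⊆ kappa
    & forall (a : S) (f : El a -> El kappa), a ∈ kappa ->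
        exists2 b, b ∈ kappa & forall t, sval (f t) ∈ b].

(* Since kappa is an initial ordinal, its members are the smaller ordinals. *)
Definition card_lt (S : zfc) (x kappa : S) : Prop :=
  exists2 a, a ∈ kappa & equipotent x a.

(** * Categories *)

(* Categories on arbitrary types; the set-sized ones are [set_category]. *)
Record category := Category {
  ob :> Type;
  hom : ob -> ob -> Type;
  ident : forall a, hom a a;
  compose : forall a b c, hom b c -> hom a b -> hom a c;
  compose_idl : forall a b (f : hom a b), compose (ident b) f = f;
  compose_idr : forall a b (f : hom a b), compose f (ident a) = f;
  compose_assoc : forall a b c d (h : hom c d) (g : hom b c) (f : hom a b),
    compose h (compose g f) = compose (compose h g) f
}.

Arguments ident {_} a.

Notation "g ∘ f" := (compose g f) (at level 40, left associativity).

Record functor (C D : category) := Functor {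
  fob :> C -> D;
  fmap : forall a b, hom a b -> hom (fob a) (fob b);
  fmap_id : forall a, fmap (ident a) = ident (fob a);
  fmap_comp : forall a b c (g : hom b c) (f : hom a b),
    fmap (g ∘ f) = fmap g ∘ fmap f
}.

Arguments fmap {C D} _ {a b} _.

Definition functor_id (C : category) : functor C C :=
  @Functor C C (fun a => a) (fun _ _ f => f)
    (fun _ => erefl) (fun _ _ _ _ _ => erefl).

Definition functor_comp (C D E : category)
  (G : functor D E) (F : functor C D) : functor C E.
Proof.
refine (@Functor C E (fun a => G (F a)) (fun _ _ f => fmap G (fmap F f)) _ _).
- by move=> a; rewrite !fmap_id.
- by move=> a b c g f; rewrite !fmap_comp.
Defined.

Record nat_trans (C D : category) (F G : functor C D) := NatTrans {
  component :> forall a, hom (F a) (G a);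
  naturality : forall a b (f : hom a b),
    component b ∘ fmap F f = fmap G f ∘ component a
}.

Definition nat_id (C D : category) (F : functor C D) : nat_trans F F.
Proof.
refine (@NatTrans C D F F (fun a => ident (F a)) _).
by move=> a b f; rewrite compose_idl compose_idr.
Defined.

(* The identity, seen as a transformation between strictly equal functors. *)
Definition nat_of_eq (C D : category) (F G : functor C D) (e : F = G) :
  nat_trans F G :=
  match e in _ = G' return nat_trans F G' with erefl => nat_id F end.

Definition is_iso (C : category) (a b : C) (f : hom a b) : Prop :=
  exists g : hom b a, g ∘ f = ident a /\ f ∘ g = ident b.

Definition is_nat_iso (C D : category) (F G : functor C D)
  (t : nat_trans F G) : Prop :=
  forall a, is_iso (t a).

Definition fully_faithful (C D : category) (F : functor C D) : Prop :=
  forall a b : C, bijective (fun f : hom a b => fmap F f).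

Definition essentially_surjective (C D : category) (F : functor C D) : Prop :=
  forall b : D, exists (a : C) (f : hom (F a) b), is_iso f.

Definition full_subcategory (C : category) (P : C -> Prop) : category :=
  @Category {a : C | P a} (fun a b => hom (sval a) (sval b))
    (fun a => ident (sval a)) (fun _ _ _ g f => g ∘ f)
    (fun _ _ => @compose_idl C _ _) (fun _ _ => @compose_idr C _ _)
    (fun _ _ _ _ => @compose_assoc C _ _ _ _).

Definition restrict_functor (C D : category) (P : C -> Prop) (Q : D -> Prop)
  (F : functor C D) (PQ : forall a, P a -> Q (F a)) :
  functor (full_subcategory P) (full_subcategory Q) :=
  @Functor (full_subcategory P) (full_subcategory Q)
    (fun a => exist _ (F (sval a)) (PQ _ (proj2_sig a)))
    (fun a b f => @fmap C D F (sval a) (sval b) f)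
    (fun a => fmap_id F (sval a))
    (fun a b c => @fmap_comp C D F (sval a) (sval b) (sval c)).

(** ** Colimits *)

Record cocone (I C : category) (X : functor I C) := Cocone {
  apex : C;
  leg : forall t, hom (X t) apex;
  leg_nat : forall s t (u : hom s t), leg t ∘ fmap X u = leg s
}.

Definition is_colimit (I C : category) (X : functor I C) (c : cocone X) :=
  forall d : cocone X, exists! h : hom (apex c) (apex d),
    forall t, h ∘ leg c t = leg d t.

Definition has_colimit (I C : category) (X : functor I C) : Prop :=
  exists c : cocone X, is_colimit c.

Definition map_cocone (I C D : category) (F : functor C D) (X : functor I C)
  (c : cocone X) : cocone (functor_comp F X).
Proof.
refine (@Cocone _ _ (functor_comp F X) (F (apex c))
          (fun t => fmap F (leg c t)) _).
by move=> s t u /=; rewrite -fmap_comp leg_nat.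
Defined.

Definition preserves_colimits_of (I C D : category) (F : functor C D)
  (X : functor I C) : Prop :=
  forall c : cocone X, is_colimit c -> is_colimit (map_cocone F c).

(* The sufficiently large category of sets in which representable functors
   take their values; it is also closed under the quotients computing the
   colimits of set-indexed diagrams. *)
Definition Types : category :=
  @Category Type (fun X Y => X -> Y) (fun _ x => x) (fun _ _ _ g f x => g (f x))
    (fun _ _ _ => erefl) (fun _ _ _ => erefl) (fun _ _ _ _ _ _ _ => erefl).

(** ** Adjunctions and the Beck-Chevalley conditions *)

Record adjunction (C D : category) (F : functor C D) (G : functor D C) :=
  Adjunction {
    adj_unit : nat_trans (functor_id C) (functor_comp G F);
    adj_counit : nat_trans (functor_comp F G) (functor_id D);
    triangle_left : forall a,
      adj_counit (F a) ∘ fmap F (adj_unit a) = ident (F a);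
    triangle_right : forall d,
      fmap G (adj_counit d) ∘ adj_unit (G d) = ident (G d)
  }.

Definition left_mate (C D C' D' : category)
  (F : functor C D) (G : functor D C) (adj : adjunction F G)
  (F' : functor C' D') (G' : functor D' C') (adj' : adjunction F' G')
  (H : functor C C') (K : functor D D')
  (alpha : nat_trans (functor_comp H G) (functor_comp G' K)) :
  nat_trans (functor_comp F' H) (functor_comp K F).
Proof.
refine (@NatTrans _ _ (functor_comp F' H) (functor_comp K F)
  (fun a => adj_counit adj' (K (F a)) ∘
            (fmap F' (alpha (F a)) ∘ fmap F' (fmap H (adj_unit adj a)))) _).
move=> a b f /=; rewrite -!compose_assoc -!fmap_comp.
have /= e1 := naturality (adj_unit adj) f.
have /= e2 := naturality alpha (fmap F f).
have /= e3 := naturality (adj_counit adj') (fmap K (fmap F f)).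
by rewrite e1 (fmap_comp H) compose_assoc e2 -compose_assoc (fmap_comp F')
  compose_assoc e3 -compose_assoc.
Defined.

Definition right_mate (C D C' D' : category)
  (F : functor C D) (G : functor D C) (adj : adjunction F G)
  (F' : functor C' D') (G' : functor D' C') (adj' : adjunction F' G')
  (H : functor C C') (K : functor D D')
  (beta : nat_trans (functor_comp F' H) (functor_comp K F)) :
  nat_trans (functor_comp H G) (functor_comp G' K).
Proof.
refine (@NatTrans _ _ (functor_comp H G) (functor_comp G' K)
  (fun d => fmap G' (fmap K (adj_counit adj d)) ∘
            (fmap G' (beta (G d)) ∘ adj_unit adj' (H (G d)))) _).
move=> a b f /=.
have /= e1 := naturality (adj_unit adj') (fmap H (fmap G f)).
have /= e2 := naturality beta (fmap G f).
have /= e3 := naturality (adj_counit adj) f.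
rewrite -!compose_assoc e1 (compose_assoc (fmap G' (beta (G b)))).
by rewrite -fmap_comp e2 fmap_comp !compose_assoc -!fmap_comp e3.
Defined.

Definition left_beck_chevalley (C D C' D' : category)
  (F : functor C D) (G : functor D C) (adj : adjunction F G)
  (F' : functor C' D') (G' : functor D' C') (adj' : adjunction F' G')
  (H : functor C C') (K : functor D D')
  (alpha : nat_trans (functor_comp H G) (functor_comp G' K)) : Prop :=
  is_nat_iso (left_mate adj adj' alpha).

Definition right_beck_chevalley (C D C' D' : category)
  (F : functor C D) (G : functor D C) (adj : adjunction F G)
  (F' : functor C' D') (G' : functor D' C') (adj' : adjunction F' G')
  (H : functor C C') (K : functor D D')
  (beta : nat_trans (functor_comp F' H) (functor_comp K F)) : Prop :=
  is_nat_iso (right_mate adj adj' beta).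

(** * Set-sized categories *)

Definition arrows (S : zfc) (O M : S) (d c : El M -> El O)
  (a b : El O) : Type :=
  {f : El M | d f = a /\ c f = b}.

Record set_category (S : zfc) := SetCategory {
  objects : S;
  morphisms : S;
  dom : El morphisms -> El objects;
  cod : El morphisms -> El objects;
  set_ident : forall a, arrows dom cod a a;
  set_compose : forall a b c,
    arrows dom cod b c -> arrows dom cod a b -> arrows dom cod a c;
  set_compose_idl : forall a b (f : arrows dom cod a b),
    set_compose (set_ident b) f = f;
  set_compose_idr : forall a b (f : arrows dom cod a b),
    set_compose f (set_ident a) = f;
  set_compose_assoc : forall a b c d
    (h : arrows dom cod c d) (g : arrows dom cod b c) (f : arrows dom cod a b),
    set_compose h (set_compose g f) = set_compose (set_compose h g) f
}.

Definition category_of (S : zfc) (C : set_category S) : category :=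
  Category (@set_compose_idl S C) (@set_compose_idr S C)
    (@set_compose_assoc S C).

Coercion category_of : set_category >-> category.

Definition hom_set (S : zfc) (C : set_category S) (a b : C) : S :=
  sep (morphisms C) (fun f => exists fM : f ∈ morphisms C,
    dom (exist _ f fM) = a /\ cod (exist _ f fM) = b).

Definition small (S : zfc) (U : S) (C : set_category S) : Prop :=
  objects C ∈ U /\ morphisms C ∈ U.

Definition locally_small (S : zfc) (U : S) (C : set_category S) : Prop :=
  [/\ objects C ⊆ U, morphisms C ⊆ U & forall a b : C, hom_set a b ∈ U].

Definition filtered (S : zfc) (kappa : S) (I : set_category S) : Prop :=
  forall J : set_category S, card_lt (morphisms J) kappa ->
  forall X : functor J I, inhabited (cocone X).

(** ** Accessible categories and functors *)

Definition hom_functor (C : category) (a : C) : functor C Types.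
Proof.
refine (@Functor C Types (fun b => hom a b) (fun _ _ g f => g ∘ f) _ _).
- by move=> b; apply: functional_extensionality => f; apply: compose_idl.
- move=> b c d g f; apply: functional_extensionality => h /=.
  by rewrite compose_assoc.
Defined.

Definition preserves_filtered_colimits (S : zfc) (kappa U : S)
  (C D : category) (F : functor C D) : Prop :=
  forall I : set_category S, small U I -> filtered kappa I ->
  forall X : functor I C, preserves_colimits_of F X.

Definition compact (S : zfc) (kappa U : S) (C : category) (a : C) : Prop :=
  preserves_filtered_colimits kappa U (hom_functor a).

Definition accessible_category (S : zfc) (kappa U : S) (C : set_category S) :
  Prop :=
  [/\ locally_small U C,
      forall I : set_category S, small U I -> filtered kappa I ->
        forall X : functor I C, has_colimit X
    & exists G : S,
        [/\ G ∈ U, G ⊆ objects C,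
            forall a : C, sval a ∈ G -> compact kappa U a
          & forall a : C, exists I : set_category S,
              [/\ small U I, filtered kappa I
                & exists (X : functor I C) (c : cocone X),
                    [/\ forall t, sval (X t) ∈ G, is_colimit c & apex c = a]]]].

Definition locally_presentable_category (S : zfc) (kappa U : S)
  (C : set_category S) : Prop :=
  accessible_category kappa U C /\
  forall I : set_category S, small U I ->
    forall X : functor I C, has_colimit X.

Definition accessible_functor (S : zfc) (kappa U : S) (C D : set_category S)
  (F : functor C D) : Prop :=
  accessible_category kappa U C /\ preserves_filtered_colimits kappa U F.

Definition accessible_extension (S : zfc) (kappa U Up : S)
  (C Cp : set_category S) (i : functor C Cp) : Prop :=
  [/\ accessible_functor kappa U i,
      accessible_category kappa U C,
      accessible_category kappa Up Cp
    & exists i_compact :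
        forall a : C, compact kappa U a -> compact kappa Up (i a),
        fully_faithful (restrict_functor i_compact) /\
        essentially_surjective (restrict_functor i_compact)].

(* Main.v *)
From Stdlib Require Import Classical ClassicalEpsilon FunctionalExtensionality
  PropExtensionality ProofIrrelevance.
Require Import Defs.
From mathcomp Require Import ssreflect ssrfun ssrbool.

Set Implicit Arguments.
Unset Strict Implicit.
Unset Printing Implicit Defensive.

(* Over the kappa-compact objects, which generate C, the functor i is fully
   faithful by definition, and compactness of their images spreads this to all
   of C. With i and j fully faithful, the mate in (ii) is bijective on maps out
   of the generators i c of Cp, and the mate Fp (i a) -> j (F a) in (i) is
   bijective on maps into objects j d. So (i) reduces to showing that Fp (i a)
   lies in the essential image of j. Now a is a small colimit of kappa-compact
   objects, so Fp (i a) is a U-small colimit of lambda-compact objects of Dp.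
   Such a colimit is a lambda-filtered colimit, over the poset of sets of fewer
   than lambda arrows of the diagram, of colimits of pieces of size less than
   lambda. The latter are lambda-compact, hence in the image of j, and the image
   of j is closed under U-small lambda-filtered colimits. *)

(** * Choice, bijections and subtypes *)

Lemma dependent_choice_on (A : Type) (B : A -> Type) (R : forall a, B a -> Prop) :
  (forall a, exists b, R a b) -> exists f : forall a, B a, forall a, R a (f a).
Proof.
move=> h.
exists (fun a => proj1_sig (constructive_indefinite_description _ (h a))).
by move=> a; case: constructive_indefinite_description.
Qed.

Lemma injective_surjective_bijective (A B : Type) (f : A -> B) :
  injective f -> (forall b, exists a, f a = b) -> bijective f.
Proof.
move=> inj /dependent_choice_on [g fg]; exists g => // a.
exact/inj/fg.
Qed.

Lemma bijective_surjective (A B : Type) (f : A -> B) :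
  bijective f -> forall b, exists a, f a = b.
Proof. by move=> [g _ fg] b; exists (g b). Qed.

Lemma sig_eq (A : Type) (P : A -> Prop) (x y : {a | P a}) :
  sval x = sval y -> x = y.
Proof.
by case: x y => [x px] [y py] /= e; subst y; rewrite (proof_irrelevance _ px py).
Qed.

Definition el (S : zfc) (x y : S) (yx : y ∈ x) : El x :=
  exist (fun z => z ∈ x) y yx.

(** * Sizes below a regular cardinal *)

(* For a regular cardinal lambda, these are the types of size less than
   lambda; see [bounded_enumeration]. *)
Definition bounded (S : zfc) (lambda : S) (A : Type) : Prop :=
  forall f : A -> El lambda,
    exists2 b, b ∈ lambda & forall t, sval (f t) ∈ b.

Lemma bounded_member (S : zfc) (lambda a : S) :
  regular_cardinal lambda -> a ∈ lambda -> bounded lambda (El a).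
Proof. by move=> [_ _ reg] al f; apply: reg. Qed.

Lemma bounded_surj (S : zfc) (lambda : S) (A B : Type) (q : A -> B) :
  (forall b, exists a, q a = b) -> bounded lambda A -> bounded lambda B.
Proof.
move=> qs bA f; case: (bA (f \o q)) => b bl h; exists b => // t.
by case: (qs t) => a <-; apply: h.
Qed.

Lemma bounded_inj (S : zfc) (lambda : S) (A B : Type) (q : B -> A) :
  regular_cardinal lambda -> injective q -> bounded lambda A ->
  bounded lambda B.
Proof.
move=> [_ wl _] qi bA f.
have zl : emptyset S ∈ lambda by apply: wl; apply: omega0.
have [g gP] : exists g : A -> El lambda, forall a b, q b = a -> g a = f b.
  apply: (@dependent_choice_on A (fun _ => El lambda)
    (fun a y => forall b, q b = a -> y = f b)) => a.
  case: (classic (exists b, q b = a)) => [[b <-]|n].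
    by exists (f b) => b' /qi ->.
  (* Off the image of [q] any value works; the default is the empty set, a member of [lambda]
     because [omega] is contained in it. *)
  by exists (el zl) => b e; case: n; exists b.
case: (bA g) => b bl h; exists b => // t.
by rewrite -(gP _ _ erefl).
Qed.

Lemma ordinal_mem (S : zfc) (x y : S) : ordinal x -> y ∈ x -> ordinal y.
Proof. by move=> [tx h] yx; split=> [|z zy]; apply: h => //; apply: (tx y). Qed.

(** By double membership induction: when neither of [x] and [y] belongs to the other, the induction
    hypotheses and transitivity give them the same members. *)
Lemma ordinal_trichotomy (S : zfc) (x y : S) :
  ordinal x -> ordinal y -> [\/ x ∈ y, x = y | y ∈ x].
Proof.
elim/(well_founded_induction (@mem_wf S)): x y => x IHx.
elim/(well_founded_induction (@mem_wf S)) => y IHy ox oy.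
case: (classic (x ∈ y)) => [|nxy]; first by constructor 1.
case: (classic (y ∈ x)) => [|nyx]; first by constructor 3.
constructor 2; apply: mem_ext => z; split=> hz.
  case: (IHx z hz y (ordinal_mem ox hz) oy) => // [e|yz]; case: nyx.
    by rewrite -e.
  by case: ox => tx _; apply: (tx z).
case: (IHy z hz ox (ordinal_mem oy hz)) => // [xz|e]; case: nxy.
  by case: oy => ty _; apply: (ty z).
by rewrite e.
Qed.

(** Bound each fibre by some [g a], then bound the family [g] by [b]; transitivity of the ordinal
    [b] combines the two bounds. *)
Lemma bounded_sigma (S : zfc) (lambda : S) (A : Type) (B : A -> Type) :
  regular_cardinal lambda -> bounded lambda A ->
  (forall a, bounded lambda (B a)) -> bounded lambda {a : A & B a}.
Proof.
move=> [[[_ trl] _] _ _] bA bB f.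
have [g gP] : exists g : A -> El lambda,
    forall a (b : B a), sval (f (existT _ a b)) ∈ sval (g a).
  apply: (@dependent_choice_on A (fun _ => El lambda)
    (fun a y => forall b : B a, sval (f (existT _ a b)) ∈ sval y)) => a.
  by case: (bB a (fun b => f (existT _ a b))) => b bl h; exists (el bl).
case: (bA g) => b bl h; exists b => // -[a t].
exact: (trl b bl _ (h a)).
Qed.

(** [bool] embeds into the von Neumann numeral 2, a member of [omega] and so of [lambda]. *)
Lemma bounded_bool (S : zfc) (lambda : S) :
  regular_cardinal lambda -> bounded lambda bool.
Proof.
move=> hl; have [_ wl _] := hl.
pose s (n : S) := union (upair n (upair n n)).
have zw := @omega0 S.
have tl : s (s (emptyset S)) ∈ lambda by apply: wl; do 2 apply: omegaS.
have z2 : emptyset S ∈ s (s (emptyset S)).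
  apply/mem_union; exists (s (emptyset S)); first by apply/mem_upair; left.
  apply/mem_union; exists (upair (emptyset S) (emptyset S)).
    by apply/mem_upair; right.
  by apply/mem_upair; left.
have o2 : s (emptyset S) ∈ s (s (emptyset S)).
  apply/mem_union; exists (upair (s (emptyset S)) (s (emptyset S))).
    by apply/mem_upair; right.
  by apply/mem_upair; left.
have ne : s (emptyset S) <> emptyset S.
  move=> e; apply: (@mem_emptyset S (emptyset S)); rewrite -{2}e.
  apply/mem_union; exists (upair (emptyset S) (emptyset S)).
    by apply/mem_upair; right.
  by apply/mem_upair; left.
apply: (@bounded_inj S lambda (El (s (s (emptyset S)))) bool
  (fun b => if b then el o2 else el z2) hl); last exact: bounded_member.
by move=> [] [] //= /(congr1 (@sval _ _)) //= /esym.
Qed.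

Lemma bounded_sum (S : zfc) (lambda : S) (A B : Type) :
  regular_cardinal lambda -> bounded lambda A -> bounded lambda B ->
  bounded lambda (A + B).
Proof.
move=> hl bA bB; pose T (b : bool) : Type := if b then A else B.
apply: (@bounded_surj S lambda {b : bool & T b} _
  (fun x => match x with
            | existT true a => inl a
            | existT false b => inr b
            end)).
  by move=> [a|b]; [exists (existT T true a) | exists (existT T false b)].
by apply: bounded_sigma => [//||[]//]; apply: bounded_bool.
Qed.

Lemma bounded_prod (S : zfc) (lambda : S) (A B : Type) :
  regular_cardinal lambda -> bounded lambda A -> bounded lambda B ->
  bounded lambda (A * B).
Proof.
move=> hl bA bB.
apply: (@bounded_surj S lambda {_ : A & B} _ (fun x => (projT1 x, projT2 x))).
  by move=> [a b]; exists (existT _ a b).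
exact: bounded_sigma.
Qed.

Lemma bounded_subsingleton (S : zfc) (lambda : S) (A : Type) :
  regular_cardinal lambda -> (forall x y : A, x = y) -> bounded lambda A.
Proof.
move=> hl h; apply: (bounded_inj (q := fun _ => true) hl) (bounded_bool hl).
by move=> x y _; apply: h.
Qed.

(* Enumerate A along lambda, taking at each stage an element not yet
   enumerated; an enumeration that never stops would embed lambda into A. *)
Lemma bounded_enumeration (S : zfc) (lambda : S) (A : Type) :
  regular_cardinal lambda -> bounded lambda A ->
  exists2 a, a ∈ lambda & exists f : El a -> A, bijective f.
Proof.
move=> hl bA; have [[ol _] _ _] := hl.
(* [e x] is an element not enumerated at any member of [x], or [None] when no element is left. The
   recursion runs over all sets; only its values at members of [lambda] matter. *)
have [e eP] : exists e : S -> option A, forall x,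
    match e x with
    | Some a => forall y, y ∈ x -> e y <> Some a
    | None => forall a, exists2 y, y ∈ x & e y = Some a
    end.
  pose F (x : S) (g : forall y, y ∈ x -> option A) : option A :=
    match excluded_middle_informative
            (exists a, forall y (yx : y ∈ x), g y yx <> Some a) with
    | left h => Some (proj1_sig (constructive_indefinite_description _ h))
    | right _ => None
    end.
  exists (Fix (@mem_wf S) (fun _ => option A) F) => x.
  rewrite Fix_eq; last first.
    move=> {}x f g fg; congr F; apply: functional_extensionality_dep => y.
    exact: functional_extensionality_dep.
  rewrite {1}/F; case: excluded_middle_informative => [h|h].
    exact: proj2_sig (constructive_indefinite_description _ h).
  move=> a; apply: NNPP => n; apply: h; exists a => y yx ey.
  by apply: n; exists y.
have inj (x y : S) a : x ∈ lambda -> y ∈ lambda ->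
    e x = Some a -> e y = Some a -> x = y.
  move=> xl yl ex ey.
  case: (ordinal_trichotomy (ordinal_mem ol xl) (ordinal_mem ol yl)) => // h.
    by have := eP y; rewrite ey => /(_ x h).
  by have := eP x; rewrite ex => /(_ y h).
have total (x : S) : x ⊆ lambda -> (forall y, y ∈ x -> e y <> None) ->
    exists f : El x -> A, forall y, e (sval y) = Some (f y).
  move=> xl h; apply: (@dependent_choice_on _ (fun _ => A)
    (fun y a => e (sval y) = Some a)) => -[y yx] /=.
  by case E: (e y) => [a|]; [exists a | case: (h y yx E)].
have injx (x : S) (f : El x -> A) : x ⊆ lambda ->
    (forall y, e (sval y) = Some (f y)) -> injective f.
  move=> xl fP y z yz; apply: sig_eq.
  by apply: inj (fP y) _; [apply/xl/(proj2_sig y) | apply/xl/(proj2_sig z)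
                         | rewrite yz].
case: (classic (exists2 x, x ∈ lambda & e x = None)) => [|n]; last first.
  have [|f fP] := total lambda (fun _ => id).
    by move=> y yl ey; apply: n; exists y.
  (* [El lambda] would be bounded, and a bound for its identity map would be a member [b] of
     [lambda] that belongs to itself. *)
  have [b bl h] := bounded_inj hl (injx _ _ (fun _ => id) fP) bA id.
  elim/(well_founded_induction (@mem_wf S)): b bl h => b IH bl h.
  by apply: (IH b) => //; apply: (h (el bl)).
(* At a minimal stage [x] with [e x = None], the enumeration is total and injective on the members
   of [x], and stopping means that it is onto. *)
move=> [x]; elim/(well_founded_induction (@mem_wf S)): x => x IH xl ex.
case: (classic (exists2 y, y ∈ x & e y = None)) => [[y yx ey]|n].
  by apply: (IH y yx) => //; case: ol => trl _; apply: (trl x).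
have xl' : x ⊆ lambda by case: ol => trl _; apply: trl.
have [|f fP] := total x xl'; first by move=> y yx ey; apply: n; exists y.
exists x => //; exists f; apply: injective_surjective_bijective.
  exact: injx fP.
move=> a; have := eP x; rewrite ex => /(_ a) [y yx ey].
exists (el yx); have := fP (el yx); rewrite /= ey.
by case.
Qed.

Lemma bounded_card_lt (S : zfc) (lambda x : S) :
  regular_cardinal lambda -> card_lt x lambda -> bounded lambda (El x).
Proof.
move=> hl [a al [f [g fK _]]].
exact: bounded_inj hl (can_inj fK) (bounded_member hl al).
Qed.

(** * Colimits and isomorphisms *)

Lemma iso_ident (C : category) (a : C) : is_iso (ident a).
Proof. by exists (ident a); rewrite compose_idl. Qed.

Lemma iso_cancel_l (C : category) (a b c : C) (f : hom b c) (g h : hom a b) :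
  is_iso f -> f ∘ g = f ∘ h -> g = h.
Proof.
move=> [f' [ff _]] /(congr1 (fun x => f' ∘ x)).
by rewrite !compose_assoc ff !compose_idl.
Qed.

Lemma iso_Types (A B : Types) (f : hom A B) : is_iso f <-> bijective f.
Proof.
split=> [[g [gf fg]]|[g gf fg]]; exists g.
- by move=> x; apply: (congr1 (fun k => k x) gf).
- by move=> x; apply: (congr1 (fun k => k x) fg).
- by split; apply: functional_extensionality.
Qed.

Lemma bijective_precompose (C : category) (a b c : C) (f : hom a b) :
  is_iso f -> bijective (fun g : hom b c => g ∘ f).
Proof.
move=> [f' [ff' f'f]]; exists (fun g => g ∘ f') => g.
  by rewrite -compose_assoc f'f compose_idr.
by rewrite -compose_assoc ff' compose_idr.
Qed.

Lemma bijective_postcompose (C : category) (a b c : C) (f : hom b c) :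
  is_iso f -> bijective (fun g : hom a b => f ∘ g).
Proof.
move=> [f' [ff' f'f]]; exists (fun g => f' ∘ g) => g.
  by rewrite compose_assoc ff' compose_idl.
by rewrite compose_assoc f'f compose_idl.
Qed.

Lemma colimit_factor (I C : category) (X : functor I C) (c d : cocone X) :
  is_colimit c -> exists h : hom (apex c) (apex d),
    forall t, h ∘ leg c t = leg d t.
Proof. by move=> /(_ d) [h [hP _]]; exists h. Qed.

Lemma colimit_eq (I C : category) (X : functor I C) (c : cocone X) (w : C)
  (g h : hom (apex c) w) :
  is_colimit c -> (forall t, g ∘ leg c t = h ∘ leg c t) -> g = h.
Proof.
move=> cP gh.
have e s t (u : hom s t) : g ∘ leg c t ∘ fmap X u = g ∘ leg c s.
  by rewrite -compose_assoc leg_nat.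
have [k [_ uk]] := cP (Cocone e).
by rewrite -(uk g) // -(uk h).
Qed.

Lemma colimit_transport (I C : category) (X Y : functor I C)
  (alpha : nat_trans X Y) (c : cocone X) (d : cocone Y)
  (theta : hom (apex c) (apex d)) :
  is_nat_iso alpha -> is_iso theta ->
  (forall t, theta ∘ leg c t = leg d t ∘ alpha t) ->
  is_colimit c -> is_colimit d.
Proof.
move=> ai ti E cP w.
have n s t (u : hom s t) :
    leg w t ∘ alpha t ∘ fmap X u = leg w s ∘ alpha s.
  by rewrite -compose_assoc naturality compose_assoc leg_nat.
have [h hP] := colimit_factor (Cocone n) cP.
have [theta' [tt' t't]] := ti.
exists (h ∘ theta'); split=> [t|k kP].
  have [g' gK _] := bijective_precompose (apex w) (ai t).
  apply: (can_inj gK); rewrite /= -[LHS]compose_assoc -E.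
  rewrite -compose_assoc (compose_assoc theta').
  by rewrite tt' compose_idl; apply: hP.
suff -> : h = k ∘ theta by rewrite -compose_assoc t't compose_idr.
apply: colimit_eq cP _ => t.
by rewrite hP -compose_assoc E compose_assoc kP.
Qed.

(** The inverse is induced by the legs of [c] precomposed with the inverses of [alpha]. This is how
    hom-set bijections at the stages of a diagram pass to the colimit. *)
Lemma colimit_comparison (I C : category) (X Y : functor I C)
  (alpha : nat_trans X Y) (c : cocone X) (d : cocone Y)
  (theta : hom (apex c) (apex d)) :
  is_nat_iso alpha -> (forall t, theta ∘ leg c t = leg d t ∘ alpha t) ->
  is_colimit c -> is_colimit d -> is_iso theta.
Proof.
move=> ai E cP dP.
have [beta bP] := dependent_choice_on ai.
have n s t (u : hom s t) : leg c t ∘ beta t ∘ fmap Y u = leg c s ∘ beta s.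
  rewrite -(leg_nat c u) -!compose_assoc; congr (_ ∘ _).
  apply: (iso_cancel_l (f := alpha t)) => //.
  rewrite !compose_assoc (proj2 (bP t)) naturality -compose_assoc.
  by rewrite (proj2 (bP s)) compose_idl compose_idr.
have [h hP] := colimit_factor (Cocone n) dP.
exists h; split.
  apply: colimit_eq cP _ => t.
  rewrite compose_idl -compose_assoc E compose_assoc hP /= -compose_assoc.
  by rewrite (proj1 (bP t)) compose_idr.
apply: colimit_eq dP _ => t.
rewrite compose_idl -compose_assoc hP /= compose_assoc E -compose_assoc.
by rewrite (proj2 (bP t)) compose_idr.
Qed.

(** * Set-sized models of categories *)

Definition arrow (C : category) : Type := {a : C & {b : C & hom a b}}.

Definition to_arrow (C : category) (a b : C) (f : hom a b) : arrow C :=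
  existT _ a (existT _ b f).

Definition source (C : category) (x : arrow C) : C := projT1 x.

Definition target (C : category) (x : arrow C) : C := projT1 (projT2 x).

Definition underlying (C : category) (x : arrow C) :
  hom (source x) (target x) := projT2 (projT2 x).

Lemma to_arrow_inj (C : category) (a b : C) : injective (@to_arrow C a b).
Proof.
move=> f g e.
exact: inj_pair2 _ _ _ _ _ (inj_pair2 _ _ _ _ _ e).
Qed.

Lemma ident_arrow_inj (C : category) :
  injective (fun a : C => to_arrow (ident a)).
Proof. by move=> a b /(congr1 (@source C)). Qed.

Definition object_surjective (C D : category) (T : functor C D) : Prop :=
  forall b, exists a, T a = b.

(** Filteredness and existence of colimits are assumed for set-sized index categories, while the
    index categories built below live on types. The structure of [J] is transported along the two
    bijections. *)
Lemma set_model (S : zfc) (J : category) (o m : S) (phi : El o -> J)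
  (rho : El m -> arrow J) :
  bijective phi -> bijective rho ->
  exists K : set_category S, [/\ objects K = o, morphisms K = m &
    exists T : functor K J, fully_faithful T /\ object_surjective T].
Proof.
move=> [psi phiK psiK] [sigma rhoK sigmaK].
pose dom f := psi (source (rho f)); pose cod f := psi (target (rho f)).
have to_hom_of a b (f : arrows dom cod a b) :
    {h : hom (phi a) (phi b) | rho (sval f) = to_arrow h}.
  case: f => f [/= <- <-]; rewrite /dom /cod !psiK.
  by exists (underlying (rho f)); case: (rho f) => x [].
pose to_hom a b f := sval (@to_hom_of a b f).
have to_homP a b f : rho (sval f) = to_arrow (@to_hom a b f).
  exact: proj2_sig (to_hom_of a b f).
have of_homP a b (h : hom (phi a) (phi b)) :
    dom (sigma (to_arrow h)) = a /\ cod (sigma (to_arrow h)) = b.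
  by rewrite /dom /cod sigmaK /source /target /= !phiK.
pose of_hom a b h : arrows dom cod a b := exist _ _ (of_homP a b h).
have of_homK a b : cancel (@of_hom a b) (@to_hom a b).
  by move=> h; apply: to_arrow_inj; rewrite -to_homP /= sigmaK.
have to_homK a b : cancel (@to_hom a b) (@of_hom a b).
  by move=> f; apply: sig_eq; rewrite /= -to_homP rhoK.
pose idK a := of_hom a a (ident (phi a)).
pose compK a b c g f := of_hom a c (to_hom b c g ∘ to_hom a b f).
have idl a b f : compK a b b (idK b) f = f.
  by rewrite /compK of_homK compose_idl to_homK.
have idr a b f : compK a a b f (idK a) = f.
  by rewrite /compK of_homK compose_idr to_homK.
have assoc a b c d h g f :
    compK a c d h (compK a b c g f) = compK a b d (compK b c d h g) f.
  by rewrite /compK !of_homK compose_assoc.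
exists (SetCategory idl idr assoc); split=> //.
have Tid a : to_hom a a (idK a) = ident (phi a) by apply: of_homK.
have Tcomp a b c g f :
    to_hom a c (compK a b c g f) = to_hom b c g ∘ to_hom a b f.
  exact: of_homK.
exists (@Functor (category_of (SetCategory idl idr assoc)) J phi to_hom Tid
  Tcomp); split=> [a b|b]; last by exists (psi b).
by exists (of_hom a b).
Qed.

(* A functor that is fully faithful and surjective on objects is an
   equivalence, so reindexing along it does not change cocones. *)
Lemma extend_cocone (K J C : category) (T : functor K J) (X : functor J C)
  (c : cocone (functor_comp X T)) :
  fully_faithful T -> object_surjective T ->
  exists l : forall t, hom (X t) (apex c),
    (forall s t (u : hom s t), l t ∘ fmap X u = l s) /\
    forall k, l (T k) = leg c k.
Proof.
move=> ff os.
(* Asking for the equation at every [f] out of every [T k] makes the choice of a preimage of [t]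
   harmless; fullness of [T] proves it. *)
have [l lP] : exists l : forall t, hom (X t) (apex c),
    forall t k (f : hom (T k) t), leg c k = l t ∘ fmap X f.
  apply: (@dependent_choice_on _ _ (fun t (l : hom (X t) (apex c)) =>
    forall k (f : hom (T k) t), leg c k = l ∘ fmap X f)) => t.
  case: (os t) => k' <-; exists (leg c k') => k f.
  case: (bijective_surjective (ff k k') f) => u <-.
  exact/esym/(leg_nat c).
exists l; split=> [s t u|k].
  case: (os s) u => k <- u; rewrite -lP (lP _ _ (ident (T k))).
  by rewrite fmap_id compose_idr.
by rewrite (lP _ _ (ident (T k))) fmap_id compose_idr.
Qed.

Definition restrict_cocone (K J C : category) (T : functor K J)
  (X : functor J C) (c : cocone X) : cocone (functor_comp X T) :=
  @Cocone _ _ (functor_comp X T) (apex c) (fun k => leg c (T k))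
    (fun _ _ u => leg_nat c (fmap T u)).

Lemma restrict_colimit (K J C : category) (T : functor K J) (X : functor J C)
  (c : cocone X) :
  fully_faithful T -> object_surjective T ->
  is_colimit c -> is_colimit (restrict_cocone T c).
Proof.
move=> ff os cP d.
have [l [ln lT]] := extend_cocone d ff os.
have [h hP] := colimit_factor (Cocone ln) cP.
exists h; split=> [t|k kP]; first by rewrite /= hP /= lT.
apply: colimit_eq cP _ => t.
by case: (os t) => s <-; rewrite hP /= lT; apply/esym/kP.
Qed.

Lemma has_colimit_model (K J C : category) (T : functor K J)
  (X : functor J C) :
  fully_faithful T -> object_surjective T ->
  has_colimit (functor_comp X T) -> has_colimit X.
Proof.
move=> ff os [c cP]; have [l [ln lT]] := extend_cocone c ff os.
exists (Cocone ln) => d.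
have [h hP] := colimit_factor (restrict_cocone T d) cP.
exists h; split=> [t|k kP].
  by case: (os t) => s <-; rewrite /= lT; apply: hP.
apply: colimit_eq cP _ => s.
by rewrite hP /= -kP /= lT.
Qed.

Lemma bounded_model (S : zfc) (lambda : S) (J : category) :
  regular_cardinal lambda -> bounded lambda (arrow J) ->
  exists K : set_category S,
    [/\ objects K ∈ lambda, morphisms K ∈ lambda &
    exists T : functor K J, fully_faithful T /\ object_surjective T].
Proof.
move=> hl bJ.
have [o ol [phi phiP]] := bounded_enumeration hl
  (bounded_inj hl (@ident_arrow_inj J) bJ).
have [m ml [rho rhoP]] := bounded_enumeration hl bJ.
have [K [Ko Km KT]] := set_model phiP rhoP.
by exists K; rewrite Ko Km.
Qed.

(** A set-sized model extends the defining property of [filtered] from set categories to every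
    bounded category. *)
Lemma filtered_cocone (S : zfc) (lambda : S) (I : set_category S)
  (J : category) (X : functor J I) :
  regular_cardinal lambda -> filtered lambda I -> bounded lambda (arrow J) ->
  inhabited (cocone X).
Proof.
move=> hl fI bJ; have [K [_ Km [T [ff os]]]] := bounded_model hl bJ.
have [|c] := fI K _ (functor_comp X T).
  by exists (morphisms K) => //; exists id; exists id.
by have [l [ln _]] := extend_cocone c ff os; constructor; apply: Cocone ln.
Qed.

(** The objects and morphisms of the set-sized model form members of [lambda], hence of [U] by
    transitivity. *)
Lemma small_colimit (S : zfc) (lambda U : S) (J C : category) (X : functor J C) :
  regular_cardinal lambda -> universe U -> lambda ∈ U ->
  (forall I : set_category S, small U I ->
    forall Y : functor I C, has_colimit Y) ->
  bounded lambda (arrow J) -> has_colimit X.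
Proof.
move=> hl [[Utr _ _ _] _] lU cc bJ.
have [K [Ko Km [T [ff os]]]] := bounded_model hl bJ.
apply: (has_colimit_model ff os); apply: cc.
by split; [apply: Utr Ko lU | apply: Utr Km lU].
Qed.

(** * Bipartite diagrams *)

(** All non-identity arrows go from [P] to [Q], so no two of them compose and a functor amounts to a
    family of maps indexed by [E]. Identities are encoded as equalities of vertices. *)
Definition bipartite_hom (P Q E : Type) (s : E -> P) (t : E -> Q)
  (x y : P + Q) : Type :=
  match x, y with
  | inl p, inl p' => p = p'
  | inl p, inr q => {e : E | s e = p /\ t e = q}
  | inr _, inl _ => False
  | inr q, inr q' => q = q'
  end.

Definition bipartite (P Q E : Type) (s : E -> P) (t : E -> Q) : category.
Proof.
refine (@Category (P + Q) (bipartite_hom s t)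
  (fun x => match x with inl _ => erefl | inr _ => erefl end)
  (fun x y z => match x, y, z with
    | inl _, inl _, inl _ => fun g f => etrans f g
    | inl _, inl _, inr _ => fun g f =>
        ecast p {e | s e = p /\ _} (esym f) g
    | inl _, inr _, inr _ => fun g f => ecast q {e | _ /\ t e = q} g f
    | inr _, inr _, inr _ => fun g f => etrans f g
    | inl _, inr _, inl _ => fun g _ => False_rect _ g
    | inr _, inl _, _ => fun _ f => False_rect _ f
    | inr _, inr _, inl _ => fun g _ => False_rect _ g
    end) _ _ _).
- by move=> [p|q] [p'|q'] //= f; subst.
- by move=> [p|q] [p'|q'] //= f; subst.
- by move=> [p|q] [p'|q'] [p''|q''] [p'''|q'''] //= h g f; subst.
Defined.

Lemma bounded_bipartite (S : zfc) (lambda : S) (P Q E : Type)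
  (s : E -> P) (t : E -> Q) :
  regular_cardinal lambda ->
  bounded lambda P -> bounded lambda Q -> bounded lambda E ->
  bounded lambda (arrow (bipartite s t)).
Proof.
move=> hl bP bQ bE.
have bPQ := bounded_sum hl bP bQ.
apply: bounded_sigma => // x; apply: bounded_sigma => // y.
case: x y => [p|q] [p'|q'] /=.
- by apply: bounded_subsingleton => // x y; apply: proof_irrelevance.
- by apply: (bounded_inj (q := @sval _ _) hl) bE => x y; apply: sig_eq.
- by apply: bounded_subsingleton.
- by apply: bounded_subsingleton => // x y; apply: proof_irrelevance.
Qed.

Definition bipartite_functor (P Q E : Type) (s : E -> P) (t : E -> Q)
  (C : category) (XP : P -> C) (XQ : Q -> C)
  (f : forall e, hom (XP (s e)) (XQ (t e))) : functor (bipartite s t) C.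
Proof.
refine (@Functor (bipartite s t) C
  (fun x => match x with inl p => XP p | inr q => XQ q end)
  (fun x y => match x, y with
    | inl p, inl _ => fun u => ecast p' (hom (XP p) (XP p')) u (ident _)
    | inl p, inr q => fun u =>
        let: exist e (conj es et) := u in
        ecast q (hom (XP p) (XQ q)) et (ecast p (hom (XP p) _) es (f e))
    | inr _, inl _ => fun u => False_rect _ u
    | inr q, inr _ => fun u => ecast q' (hom (XQ q) (XQ q')) u (ident _)
    end) _ _).
- by move=> [p|q].
- move=> [p|q] [p'|q'] [p''|q''] //= g u; subst=> //=;
  by rewrite ?compose_idl ?compose_idr.
Defined.

Lemma bipartite_leg (P Q E : Type) (s : E -> P) (t : E -> Q)
  (C : category) (XP : P -> C) (XQ : Q -> C)
  (f : forall e, hom (XP (s e)) (XQ (t e)))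
  (c : cocone (bipartite_functor f)) (e : E) :
  leg c (inr (t e)) ∘ f e = leg c (inl (s e)).
Proof.
pose u : bipartite_hom s t (inl (s e)) (inr (t e)) :=
  exist _ e (conj erefl erefl).
exact (@leg_nat (bipartite s t) _ _ c (inl (s e)) (inr (t e)) u).
Qed.

Lemma bipartite_cocone (P Q E : Type) (s : E -> P) (t : E -> Q)
  (C : category) (XP : P -> C) (XQ : Q -> C)
  (f : forall e, hom (XP (s e)) (XQ (t e))) (w : C)
  (lP : forall p, hom (XP p) w) (lQ : forall q, hom (XQ q) w) :
  (forall e, lQ (t e) ∘ f e = lP (s e)) ->
  let l x := match x return hom (bipartite_functor f x) w with
             | inl p => lP p | inr q => lQ q end in
  forall (x y : bipartite s t) (u : hom x y),
    l y ∘ fmap (bipartite_functor f) u = l x.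
Proof.
move=> h l [p|q] [p'|q'] //=.
- by case: _ /; rewrite compose_idr.
- by move=> [e [ep eq]]; case: _ / ep; case: _ / eq; apply: h.
- by case: _ /; rewrite compose_idr.
Qed.

(** Take a cocone on the bipartite diagram with left vertices [x a], right vertices [u r] and two
    edges [v r] and [w r] for each [r]; [k] and [k'] are its legs. *)
Lemma filtered_amalgam (S : zfc) (lambda : S) (I : set_category S)
  (A R : Type) (s t : R -> A) (x : A -> I) (u : R -> I)
  (v : forall r, hom (x (s r)) (u r)) (w : forall r, hom (x (t r)) (u r)) :
  regular_cardinal lambda -> filtered lambda I ->
  bounded lambda A -> bounded lambda R ->
  exists z (k : forall a, hom (x a) z), forall r,
    exists k' : hom (u r) z, k' ∘ v r = k (s r) /\ k' ∘ w r = k (t r).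
Proof.
move=> hl fI bA bR.
(* Indexing the edges by the members of a set, instead of by R, keeps the
   homs of the bipartite category in a low enough type-theoretic universe. *)
have [m ml [rho rhoP]] := bounded_enumeration hl bR.
pose src (e : El m * bool) := if e.2 then t (rho e.1) else s (rho e.1).
pose f (e : El m * bool) : hom (x (src e)) (u (rho e.1)) :=
  match e return hom (x (src e)) (u (rho e.1)) with
  | (n, true) => w (rho n)
  | (n, false) => v (rho n)
  end.
have bm := bounded_member hl ml.
have bE := bounded_prod hl bm (bounded_bool hl).
have [c] := filtered_cocone (@bipartite_functor _ _ _ src fst _ x (u \o rho) f)
  hl fI (bounded_bipartite hl bA bm bE).
exists (apex c), (fun a => leg c (inl a)) => r.
case: (bijective_surjective rhoP r) => n <-; exists (leg c (inr n)); split.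
- exact: bipartite_leg c (n, false).
- exact: bipartite_leg c (n, true).
Qed.

(** * Filtered colimits of types *)

(** [Prop] acts as a subobject classifier: the predicate of being hit by a leg and the constantly
    true one agree on all legs, hence are equal. *)
Lemma Types_colimit_surjective (I : category) (Y : functor I Types)
  (c : cocone Y) :
  is_colimit c -> forall x : apex c, exists t y, leg c t y = x.
Proof.
move=> cP x.
have : (fun x : apex c => exists t y, leg c t y = x) = (fun _ => True).
  apply: (@colimit_eq I Types Y c Prop _ _ cP) => t /=.
  apply: functional_extensionality => y; apply: propositional_extensionality.
  by split=> // _; exists t, y.
by move=> /(congr1 (fun k => k x)) ->.
Qed.

(** The predicate of becoming equal to [x] at some later stage is a cocone to [Prop], so it depends
    only on the image of its argument in the colimit. *)
Lemma Types_filtered_colimit_eq (S : zfc) (lambda : S) (I : set_category S)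
  (Y : functor I Types) (c : cocone Y) :
  regular_cardinal lambda -> filtered lambda I -> is_colimit c ->
  forall (s t : I) (x : Y s) (y : Y t), leg c s x = leg c t y ->
  exists u (v : hom s u) (w : hom t u), fmap Y v x = fmap Y w y.
Proof.
move=> hl fI cP s t x y xy.
pose meets t (y : Y t) : Prop :=
  exists u (v : hom s u) (w : hom t u), fmap Y v x = fmap Y w y.
have n a b (f : hom a b) :
    (meets b : @hom Types (Y b) Prop) ∘ fmap Y f = meets a.
  apply: functional_extensionality => z; apply: propositional_extensionality.
  split=> -[u [v [w e]]].
    by exists u, v, (w ∘ f); rewrite fmap_comp.
  (* Complete the span formed by [w] and [f] out of [a]: both families of edges are the same, and
     the only left vertex is [a]. *)
  have [z' [k kP]] := @filtered_amalgam S lambda I unit bool (fun _ => tt)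
    (fun _ => tt) (fun _ => a) (fun r => if r then u else b)
    (fun r => match r return hom a (if r then u else b) with
              | true => w | false => f end)
    (fun r => match r return hom a (if r then u else b) with
              | true => w | false => f end) hl fI
    (bounded_subsingleton hl (fun x y => match x, y with tt, tt => erefl end))
    (bounded_bool hl).
  have [k1 [e1 _]] := kP true; have [k2 [e2 _]] := kP false.
  exists z', (k1 ∘ v), k2; rewrite fmap_comp /= e.
  have -> : fmap Y k1 (fmap Y w z) = fmap Y (k1 ∘ w) z by rewrite fmap_comp.
  have -> : fmap Y k2 (fmap Y f z) = fmap Y (k2 ∘ f) z by rewrite fmap_comp.
  by rewrite e1 e2.
have [h hP] := colimit_factor (Cocone n) cP.
have hE a (z : Y a) : h (leg c a z) = meets a z.
  exact: (congr1 (fun k => k z) (hP a)).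
suff: meets t y by [].
rewrite -hE -xy hE.
by exists s, (ident s), (ident s).
Qed.

(** The mediating map is defined on representatives; the second hypothesis makes it independent of
    their choice. *)
Lemma Types_colimit_intro (I : category) (Y : functor I Types) (c : cocone Y) :
  (forall x : apex c, exists t y, leg c t y = x) ->
  (forall (s t : I) (x : Y s) (y : Y t), leg c s x = leg c t y ->
    exists u (v : hom s u) (w : hom t u), fmap Y v x = fmap Y w y) ->
  is_colimit c.
Proof.
move=> surj id d.
have [h hP] : exists h : apex c -> apex d,
    forall x t y, leg c t y = x -> h x = leg d t y.
  apply: (@dependent_choice_on _ (fun _ => apex d)
    (fun x z => forall t y, leg c t y = x -> z = leg d t y)) => x.
  case: (surj x) => s [z <-]; exists (leg d s z) => t y /esym.
  move=> /id [u [v [w e]]].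
  rewrite -(leg_nat d v) -(leg_nat d w) /=.
  by rewrite e.
exists h; split=> [t|k kP].
  by apply: functional_extensionality => y; apply: hP.
apply: functional_extensionality => x; case: (surj x) => t [y <-].
by rewrite (hP _ _ _ erefl) -kP.
Qed.

(** * Compact objects *)

Lemma compact_factor (S : zfc) (lambda U : S) (C : category) (a : C)
  (I : set_category S) (Y : functor I C) (c : cocone Y) :
  compact lambda U a -> small U I -> filtered lambda I -> is_colimit c ->
  forall f : hom a (apex c), exists t (g : hom a (Y t)), leg c t ∘ g = f.
Proof.
by move=> ka sI fI cP; apply: Types_colimit_surjective (ka I sI fI Y c cP).
Qed.

Lemma compact_identify (S : zfc) (lambda U : S) (C : category) (a : C)
  (I : set_category S) (Y : functor I C) (c : cocone Y) :
  regular_cardinal lambda ->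
  compact lambda U a -> small U I -> filtered lambda I -> is_colimit c ->
  forall (s t : I) (g : hom a (Y s)) (h : hom a (Y t)),
  leg c s ∘ g = leg c t ∘ h ->
  exists u (v : hom s u) (w : hom t u), fmap Y v ∘ g = fmap Y w ∘ h.
Proof.
move=> hl ka sI fI cP.
exact: Types_filtered_colimit_eq hl fI (ka I sI fI Y c cP).
Qed.

(** A map out of [apex d] is a compatible family of maps out of the [X a]. Each member factors
    through some stage, and since [J] has fewer than [lambda] arrows, one later stage serves them
    all. *)
Lemma colimit_compact (S : zfc) (lambda U : S) (J C : category)
  (X : functor J C) (d : cocone X) :
  regular_cardinal lambda -> bounded lambda (arrow J) ->
  (forall a, compact lambda U (X a)) -> is_colimit d ->
  compact lambda U (apex d).
Proof.
move=> hl bJ kX dP I sI fI Y c cP.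
have bO := bounded_inj hl (@ident_arrow_inj J) bJ.
apply: Types_colimit_intro => [f|s t g h] /=.
- have [x] := dependent_choice_on
    (fun a => compact_factor (kX a) sI fI cP (f ∘ leg d a)).
  move=> /dependent_choice_on [g gP].
  (* The chosen lifts are compatible in the colimit only; each arrow of [J] gives one equation to be
     realised at a later stage. *)
  have E (r : arrow J) : leg c (x (target r)) ∘ (g (target r) ∘
      fmap X (underlying r)) = leg c (x (source r)) ∘ g (source r).
    by rewrite compose_assoc !gP -compose_assoc leg_nat.
  have [u] := dependent_choice_on
    (fun r => compact_identify hl (kX (source r)) sI fI cP (E r)).
  move=> /dependent_choice_on [v] /dependent_choice_on [w vw].
  have [z [k kP]] := filtered_amalgam v w hl fI bO bJ.
  have n a b (r : hom a b) :
      fmap Y (k b) ∘ g b ∘ fmap X r = fmap Y (k a) ∘ g a.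
    have [k' [<- <-]] := kP (to_arrow r).
    rewrite !fmap_comp -!compose_assoc; congr (_ ∘ _).
    by rewrite -(vw (to_arrow r)).
  have [h hP] := colimit_factor (Cocone n) dP.
  exists z, h; apply: colimit_eq dP _ => a.
  by rewrite -compose_assoc hP /= compose_assoc leg_nat.
- move=> gh.
  have E a : leg c s ∘ (g ∘ leg d a) = leg c t ∘ (h ∘ leg d a).
    by rewrite !compose_assoc gh.
  have [u] := dependent_choice_on
    (fun a => compact_identify hl (kX a) sI fI cP (E a)).
  move=> /dependent_choice_on [v] /dependent_choice_on [w vw].
  (* Only the stages [s] and [t] are amalgamated, with one condition for each object of [J]. *)
  have [z [k kP]] := @filtered_amalgam S lambda I bool J (fun _ => true)
    (fun _ => false) (fun b => if b then s else t) u v w hl fI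
    (bounded_bool hl) bO.
  exists z, (k true), (k false); apply: colimit_eq dP _ => a.
  have [k' [<- <-]] := kP a.
  by rewrite !fmap_comp -!compose_assoc; congr (_ ∘ _); apply: vw.
Qed.

(** * Adjunctions *)

Lemma bijective_right_cancel (A B C : Type) (f : A -> B) (g : B -> C) :
  bijective f -> bijective (fun a => g (f a)) -> bijective g.
Proof.
move=> [f' fK f'K] [h hK h'K]; exists (fun c => f (h c)) => [b|c].
  by rewrite -{1}(f'K b) hK f'K.
exact: h'K.
Qed.

Lemma transposeK (C D : category) (F : functor C D) (G : functor D C)
  (adj : adjunction F G) (a : C) (d : D) (g : hom (F a) d) :
  adj_counit adj d ∘ fmap F (fmap G g ∘ adj_unit adj a) = g.
Proof.
rewrite fmap_comp compose_assoc (naturality (adj_counit adj) g).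
by rewrite -compose_assoc triangle_left compose_idr.
Qed.

Lemma untransposeK (C D : category) (F : functor C D) (G : functor D C)
  (adj : adjunction F G) (a : C) (d : D) (f : hom a (G d)) :
  fmap G (adj_counit adj d ∘ fmap F f) ∘ adj_unit adj a = f.
Proof.
rewrite fmap_comp -compose_assoc -(naturality (adj_unit adj) f).
by rewrite compose_assoc triangle_right compose_idl.
Qed.

Lemma transpose_bijective (C D : category) (F : functor C D)
  (G : functor D C) (adj : adjunction F G) (a : C) (d : D) :
  bijective (fun g : hom (F a) d => fmap G g ∘ adj_unit adj a).
Proof.
exists (fun f => adj_counit adj d ∘ fmap F f) => [g|f].
  exact: transposeK.
exact: untransposeK.
Qed.

Lemma untranspose_bijective (C D : category) (F : functor C D)
  (G : functor D C) (adj : adjunction F G) (a : C) (d : D) :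
  bijective (fun f : hom a (G d) => adj_counit adj d ∘ fmap F f).
Proof.
exists (fun g => fmap G g ∘ adj_unit adj a) => [f|g].
  exact: untransposeK.
exact: transposeK.
Qed.

Lemma left_adjoint_colimit (C D : category) (F : functor C D)
  (G : functor D C) (adj : adjunction F G) (I : category) (X : functor I C) :
  preserves_colimits_of F X.
Proof.
move=> c cP d.
have n s t (u : hom s t) : fmap G (leg d t) ∘ adj_unit adj (X t) ∘ fmap X u =
    fmap G (leg d s) ∘ adj_unit adj (X s).
  have /= e := leg_nat d u.
  have /= e' := naturality (adj_unit adj) (fmap X u).
  by rewrite -compose_assoc e' compose_assoc -fmap_comp e.
have [h hP] := colimit_factor (Cocone n) cP.
have [g gh] := bijective_surjective (transpose_bijective adj _ _) h.
have tr t (k : hom (F (apex c)) (apex d)) :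
    fmap G (k ∘ fmap F (leg c t)) ∘ adj_unit adj (X t) =
    fmap G k ∘ adj_unit adj (apex c) ∘ leg c t.
  have /= e := naturality (adj_unit adj) (leg c t).
  by rewrite -compose_assoc e compose_assoc fmap_comp.
exists g; split=> [t|k kP] /=.
  have [q qK _] := transpose_bijective adj (X t) (apex d).
  by apply: (can_inj qK); rewrite tr gh; apply: hP.
have [q qK _] := transpose_bijective adj (apex c) (apex d).
apply: (can_inj qK); rewrite gh; apply: colimit_eq cP _ => t.
have /= e := kP t; by rewrite hP -tr e.
Qed.

(** Maps out of [F a] into [d] correspond naturally to maps from [a] into [G d], and both [G] and
    maps out of [a] preserve the colimits in question. *)
Lemma left_adjoint_compact (S : zfc) (kappa U : S) (C D : category)
  (F : functor C D) (G : functor D C) (adj : adjunction F G) (a : C) :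
  preserves_filtered_colimits kappa U G -> compact kappa U a ->
  compact kappa U (F a).
Proof.
move=> pG ka I sI fI Y c cP.
pose beta d : @hom Types (hom a (G d)) (hom (F a) d) :=
  fun f => adj_counit adj d ∘ fmap F f.
have beta_iso d : is_iso (beta d) by apply/iso_Types/untranspose_bijective.
have nat d d' (g : hom d d') (f : hom a (G d)) :
    beta d' (fmap G g ∘ f) = g ∘ beta d f.
  rewrite /beta fmap_comp compose_assoc.
  by rewrite (naturality (adj_counit adj) g) compose_assoc.
have n s t (u : hom s t) :
    beta (Y t) ∘ fmap (functor_comp (hom_functor a) (functor_comp G Y)) u =
    fmap (functor_comp (hom_functor (F a)) Y) u ∘ beta (Y s).
  by apply: functional_extensionality => f; apply: nat.
pose alpha := @NatTrans I Types (functor_comp (hom_functor a) (functor_comp G Y))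
  (functor_comp (hom_functor (F a)) Y) (fun t => beta (Y t)) n.
refine (@colimit_transport I Types _ _ alpha
  (map_cocone (hom_functor a) (map_cocone G c))
  (map_cocone (hom_functor (F a)) c) (beta _)
  (fun t => beta_iso (Y t)) (beta_iso _) _
  (ka I sI fI _ _ (pG I sI fI Y c cP))) => t.
by apply: functional_extensionality => f; apply: nat.
Qed.

(** * Mates *)

Lemma nat_of_eq_iso (C D : category) (F G : functor C D) (e : F = G) :
  is_nat_iso (nat_of_eq e).
Proof. by case: _ / e => a; apply: iso_ident. Qed.

(** After [fmap H], composing with the mate equals transposing to [hom (F c) d], applying [K],
    precomposing with [beta c] and transposing back along the second adjunction. All these are
    bijective, so [fmap H] cancels. *)
Lemma right_mate_bijective (C D C' D' : category)
  (F : functor C D) (G : functor D C) (adj : adjunction F G)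
  (F' : functor C' D') (G' : functor D' C') (adj' : adjunction F' G')
  (H : functor C C') (K : functor D D')
  (beta : nat_trans (functor_comp F' H) (functor_comp K F)) (c : C) (d : D) :
  is_nat_iso beta ->
  bijective (fun f : hom c (G d) => fmap H f) ->
  bijective (fun f : hom (F c) d => fmap K f) ->
  bijective (fun f : hom (H c) (H (G d)) => right_mate adj adj' beta d ∘ f).
Proof.
move=> bi bH bK; apply: (bijective_right_cancel bH).
apply: (eq_bij (bij_comp (transpose_bijective adj' (H c) (K d))
  (bij_comp (bijective_precompose (K d) (bi c))
  (bij_comp bK (untranspose_bijective adj c d))))) => f /=.
rewrite !fmap_comp -!compose_assoc.
have /= e1 := naturality beta f.
have /= e2 := naturality (adj_unit adj') (fmap H f).
by rewrite e2 (compose_assoc (fmap G' (beta (G d)))) -fmap_comp e1 fmap_comp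
  !compose_assoc.
Qed.

Lemma left_mate_bijective (C D C' D' : category)
  (F : functor C D) (G : functor D C) (adj : adjunction F G)
  (F' : functor C' D') (G' : functor D' C') (adj' : adjunction F' G')
  (H : functor C C') (K : functor D D')
  (alpha : nat_trans (functor_comp H G) (functor_comp G' K)) (c : C) (d : D) :
  is_nat_iso alpha ->
  bijective (fun f : hom c (G d) => fmap H f) ->
  bijective (fun f : hom (F c) d => fmap K f) ->
  bijective (fun f : hom (K (F c)) (K d) => f ∘ left_mate adj adj' alpha c).
Proof.
move=> ai bH bK; apply: (bijective_right_cancel bK).
apply: (eq_bij (bij_comp (untranspose_bijective adj' (H c) (K d))
  (bij_comp (bijective_postcompose (H c) (ai d))
  (bij_comp bH (transpose_bijective adj c d))))) => f /=.
rewrite (fmap_comp H) (compose_assoc (alpha d)).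
have /= e1 := naturality alpha f.
have /= e2 := naturality (adj_counit adj') (fmap K f).
by rewrite e1 -compose_assoc fmap_comp compose_assoc e2 -compose_assoc
  fmap_comp.
Qed.

(** * Accessible categories *)

Lemma colimit_of_compacts (S : zfc) (kappa U : S) (C : set_category S) :
  accessible_category kappa U C -> forall a : C,
  exists I : set_category S, [/\ small U I, filtered kappa I &
    exists (X : functor I C) (c : cocone X),
    [/\ forall t, compact kappa U (X t), is_colimit c & apex c = a]].
Proof.
move=> [_ _ [G [_ _ kG h]]] a.
have [I [sI fI [X [c [XG cP ca]]]]] := h a.
by exists I; split=> //; exists X, c; split=> // t; apply: kG.
Qed.

(** Every object is a colimit of compact ones, so [f] is monic. The legs of a colimit of compacts
    presenting [y] lift along [f], and being monic makes the lifts a cocone, which induces the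
    inverse. *)
Lemma compact_detect_iso (S : zfc) (kappa U : S) (C : set_category S)
  (x y : C) (f : hom x y) :
  accessible_category kappa U C ->
  (forall a : C, compact kappa U a ->
    bijective (fun g : hom a x => f ∘ g)) ->
  is_iso f.
Proof.
move=> acc bf.
have mono z (g h : hom z x) : f ∘ g = f ∘ h -> g = h.
  have [I [_ _ [X [c [kX cP cz]]]]] := colimit_of_compacts acc z.
  subst z => gh; apply: colimit_eq cP _ => t.
  have [q qK _] := bf _ (kX t); apply: (can_inj qK); cbv beta.
  by rewrite !compose_assoc gh.
have [I [_ _ [X [c [kX cP cy]]]]] := colimit_of_compacts acc y.
subst y.
have [l lP] := dependent_choice_on
  (fun t => bijective_surjective (bf _ (kX t)) (leg c t)).
have n s t (u : hom s t) : l t ∘ fmap X u = l s.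
  by apply: mono; rewrite compose_assoc !lP leg_nat.
have [g gP] := colimit_factor (Cocone n) cP.
have fg : f ∘ g = ident _.
  apply: colimit_eq cP _ => t.
  by rewrite -compose_assoc gP lP compose_idl.
exists g; split=> //.
by apply: mono; rewrite compose_assoc fg compose_idl compose_idr.
Qed.

Lemma filtered_le (S : zfc) (kappa lambda : S) (I : set_category S) :
  kappa ⊆ lambda -> filtered lambda I -> filtered kappa I.
Proof.
move=> kl fI J [a ak Ja] X; apply: fI.
by exists a => //; apply: kl.
Qed.

Lemma compact_le (S : zfc) (kappa lambda U : S) (C : category) (a : C) :
  kappa ⊆ lambda -> compact kappa U a -> compact lambda U a.
Proof. by move=> kl ka I sI fI; apply: ka sI (filtered_le kl fI). Qed.

Lemma small_le (S : zfc) (U Up : S) (I : set_category S) :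
  universe Up -> U ∈ Up -> small U I -> small Up I.
Proof.
by move=> [[tr _ _ _] _] UUp [oU mU]; split; apply: tr UUp.
Qed.

(** Present [b] as a filtered colimit of compacts. Maps out of [a] and out of [i a] both commute
    with it, and [i] is bijective at each compact stage. *)
Lemma extension_compact_hom (S : zfc) (kappa U Up : S)
  (C Cp : set_category S) (i : functor C Cp) :
  universe Up -> U ∈ Up -> accessible_extension kappa U Up i ->
  forall a b : C, compact kappa U a ->
  bijective (fun f : hom a b => fmap i f).
Proof.
move=> hUp UUp [[_ pi] acc _ [ik [ff _]]] a b ka.
have [I [sI fI [X [c [kX cP cb]]]]] := colimit_of_compacts acc b.
subst b.
pose beta w : @hom Types (hom a w) (hom (i a) (i w)) := fun f => fmap i f.
have beta_iso t : is_iso (beta (X t)).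
  exact/iso_Types/(ff (exist _ a ka) (exist _ (X t) (kX t))).
have n s t (u : hom s t) :
    beta (X t) ∘ fmap (functor_comp (hom_functor a) X) u =
    fmap (functor_comp (hom_functor (i a)) (functor_comp i X)) u ∘ beta (X s).
  by apply: functional_extensionality => f; apply: fmap_comp.
pose alpha := @NatTrans I Types (functor_comp (hom_functor a) X)
  (functor_comp (hom_functor (i a)) (functor_comp i X))
  (fun t => beta (X t)) n.
apply/(@iso_Types (hom a (apex c)) (hom (i a) (i (apex c)))).
refine (@colimit_comparison I Types _ _ alpha
  (map_cocone (hom_functor a) c)
  (map_cocone (hom_functor (i a)) (map_cocone i c)) (beta _)
  beta_iso _ (ka I sI fI X c cP) _) => [t|].
  by apply: functional_extensionality => f; apply: fmap_comp.
exact: (ik a ka) (small_le hUp UUp sI) fI _ _ (pi I sI fI X c cP).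
Qed.

(** Present [a] as a filtered colimit of compacts, which [i] preserves; maps out of it are then
    determined by their restrictions to compacts. *)
Lemma extension_fully_faithful (S : zfc) (kappa U Up : S)
  (C Cp : set_category S) (i : functor C Cp) :
  universe Up -> U ∈ Up -> accessible_extension kappa U Up i ->
  fully_faithful i.
Proof.
move=> hUp UUp ext a b.
have [[_ pi] acc _ _] := ext.
have [I [sI fI [X [c [kX cP ca]]]]] := colimit_of_compacts acc a.
subst a.
have bt t := extension_compact_hom hUp UUp ext b (kX t).
have cP' := pi I sI fI X c cP.
apply: injective_surjective_bijective => [f g fg|h].
  apply: colimit_eq cP _ => t.
  have [q qK _] := bt t; apply: (can_inj qK); cbv beta.
  by rewrite !fmap_comp fg.
have [l lP] := dependent_choice_on
  (fun t => bijective_surjective (bt t) (h ∘ fmap i (leg c t))).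
have n s t (u : hom s t) : l t ∘ fmap X u = l s.
  have [q qK _] := bt s; apply: (can_inj qK); cbv beta.
  by rewrite fmap_comp !lP -compose_assoc -fmap_comp leg_nat.
have [f fP] := colimit_factor (Cocone n) cP.
exists f; apply: colimit_eq cP' _ => t.
transitivity (fmap i (f ∘ leg c t)); first by rewrite fmap_comp.
by rewrite fP; apply: lP.
Qed.

(** * Types coded in a universe *)

(** An injection is enough: its image is a subset of a member of [U], hence itself a member of
    [U]. *)
Definition small_type (S : zfc) (U : S) (A : Type) : Prop :=
  exists2 x, x ∈ U & exists q : A -> El x, injective q.

Lemma small_type_inj (S : zfc) (U : S) (A B : Type) (q : B -> A) :
  injective q -> small_type U A -> small_type U B.
Proof.
move=> qi [x xU [r ri]]; exists x => //; exists (r \o q).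
exact: inj_comp.
Qed.

Lemma small_type_pred (S : zfc) (U : S) (A : Type) :
  universe U -> small_type U A -> small_type U (A -> Prop).
Proof.
move=> [[_ _ pU _] _] [x xU [q qi]]; exists (powerset x); first exact: pU.
pose code (p : A -> Prop) := sep x (fun y => exists2 a, p a & sval (q a) = y).
have codeP p : code p ∈ powerset x.
  by apply/mem_powerset => y /mem_sep [].
exists (fun p => el (codeP p)) => p p' /(congr1 (@sval _ _)) /= e.
have mem_code (r : A -> Prop) a : sval (q a) ∈ code r <-> r a.
  split=> [/mem_sep [_ [b rb /sig_eq/qi <-]] //|ra].
  by apply/mem_sep; split; [exact: proj2_sig (q a) | exists a].
apply: functional_extensionality => a; apply: propositional_extensionality.
by rewrite -!mem_code e.
Qed.

Lemma small_type_enumeration (S : zfc) (U : S) (A : Type) :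
  universe U -> small_type U A ->
  exists2 o, o ∈ U & exists f : El o -> A, bijective f.
Proof.
move=> [[tr _ pU _] _] [x xU [q qi]].
pose o := sep x (fun y => exists a, sval (q a) = y).
have oP a : sval (q a) ∈ o.
  by apply/mem_sep; split; [exact: proj2_sig (q a) | exists a].
exists o.
  by apply: tr (pU x xU); apply/mem_powerset => y /mem_sep [].
have [f fK qK] : bijective (fun a => el (oP a)).
  apply: injective_surjective_bijective => [a b|[y yo]].
    by move=> /(congr1 (@sval _ _)) /= /sig_eq/qi.
  have [_ [a ay]] := proj1 (mem_sep _ _ _) yo.
  by exists a; apply: sig_eq.
by exists f; exists (fun a => el (oP a)).
Qed.

Lemma small_model (S : zfc) (U : S) (J : category) :
  universe U -> small_type U (arrow J) ->
  exists2 K : set_category S, small U K &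
    exists T : functor K J, fully_faithful T /\ object_surjective T.
Proof.
move=> hU sJ.
have [o oU [phi phiP]] := small_type_enumeration hU
  (small_type_inj (@ident_arrow_inj J) sJ).
have [m mU [rho rhoP]] := small_type_enumeration hU sJ.
have [K [Ko Km KT]] := set_model phiP rhoP.
by exists K => //; split; rewrite ?Ko ?Km.
Qed.

Lemma small_arrow (S : zfc) (U : S) (I : set_category S) :
  small U I -> small_type U (arrow I).
Proof.
move=> [_ mU]; exists (morphisms I) => //.
exists (fun r : arrow I => sval (underlying r)).
move=> [a [b [f [fa fb]]]] [a' [b' [f' [fa' fb']]]] /= e.
subst; congr existT; congr existT; exact: sig_eq.
Qed.

Lemma filtered_model (S : zfc) (lambda : S) (K : set_category S)
  (P : category) (T : functor K P) :
  fully_faithful T -> object_surjective T ->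
  (forall J : set_category S, card_lt (morphisms J) lambda ->
    forall X : functor J P, inhabited (cocone X)) ->
  filtered lambda K.
Proof.
move=> ff os fP J Jl X.
have [[a l ln]] := fP J Jl (functor_comp T X).
case: (os a) => k e; subst a.
have [g gP] := dependent_choice_on
  (fun t => bijective_surjective (ff (X t) k) (l t)).
constructor; apply: (@Cocone _ _ X k g) => s t u.
have [q qK _] := ff (X s) k; apply: (can_inj qK); cbv beta.
by rewrite fmap_comp !gP; apply: ln.
Qed.

(** * Decomposition of colimits into small pieces *)

Definition bounded_subset (S : zfc) (lambda : S) (A : Type) (p : A -> Prop) :
  Prop := bounded lambda {a | p a}.

Definition bounded_subsets (S : zfc) (lambda : S) (A : Type) : category.
Proof.
refine (@Category {p : A -> Prop | bounded_subset lambda p}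
  (fun p q => forall a, sval p a -> sval q a)
  (fun _ _ x => x) (fun _ _ _ g f a x => g a (f a x)) _ _ _); by [].
Defined.

Lemma bounded_singleton (S : zfc) (lambda : S) (A : Type) (x : A) :
  regular_cardinal lambda -> bounded_subset lambda (fun a => a = x).
Proof.
move=> hl; apply: bounded_subsingleton => // -[a ax] [b bx].
by apply: sig_eq; rewrite /= ax bx.
Qed.

Lemma bounded_union (S : zfc) (lambda : S) (A : Type) (p q : A -> Prop) :
  regular_cardinal lambda -> bounded_subset lambda p ->
  bounded_subset lambda q -> bounded_subset lambda (fun a => p a \/ q a).
Proof.
move=> hl bp bq.
apply: (bounded_surj (q := fun x : {a | p a} + {a | q a} =>
  match x with
  | inl y => exist _ (sval y) (or_introl (proj2_sig y))
  | inr y => exist _ (sval y) (or_intror (proj2_sig y))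
  end)) (bounded_sum hl bp bq) => -[a [pa|qa]].
  by exists (inl (exist _ a pa)).
by exists (inr (exist _ a qa)).
Qed.

(** The union of the diagram is an upper bound, and it is bounded by [bounded_sigma]. *)
Lemma bounded_subsets_filtered (S : zfc) (lambda : S) (A : Type)
  (J : set_category S) (X : functor J (bounded_subsets lambda A)) :
  regular_cardinal lambda -> card_lt (morphisms J) lambda ->
  inhabited (cocone X).
Proof.
move=> hl Jl.
have bJ : bounded lambda J.
  apply: (bounded_surj (q := @dom S J)) (bounded_card_lt hl Jl) => t.
  by exists (sval (set_ident t)); case: (proj2_sig (set_ident t)).
have bU : bounded_subset lambda (fun a => exists t : J, sval (X t) a).
  apply: (bounded_surj (A := {t : J & {a | sval (X t) a}})
    (q := fun x => exist _ (sval (projT2 x))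
      (ex_intro _ (projT1 x) (proj2_sig (projT2 x))))).
    by move=> [a [t h]]; exists (existT _ t (exist _ a h)); apply: sig_eq.
  by apply: bounded_sigma => // t; apply: (proj2_sig (X t)).
constructor; apply: (@Cocone _ _ X (exist _ _ bU)
  (fun t a h => ex_intro _ t h)) => s t u.
exact (proof_irrelevance (forall a, sval (X s) a -> _) _ _).
Qed.

(** Two power sets suffice: one for the objects, and one for the arrows, each coded by the unordered
    pair of its endpoints. Antisymmetry of inclusion recovers the direction. *)
Lemma bounded_subsets_small (S : zfc) (lambda U : S) (A : Type) :
  universe U -> small_type U A ->
  small_type U (arrow (bounded_subsets lambda A)).
Proof.
move=> hU sA.
have sP : small_type U (bounded_subsets lambda A).
  by apply: small_type_inj (small_type_pred hU sA) => p q; apply: sig_eq.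
apply: (small_type_inj (q := fun r : arrow (bounded_subsets lambda A) =>
  fun p => p = source r \/ p = target r)) (small_type_pred hU sP).
have anti (p q : bounded_subsets lambda A) : hom p q -> hom q p -> p = q.
  move=> pq qp; apply: sig_eq; apply: functional_extensionality => a.
  by apply: propositional_extensionality; split; [apply: pq | apply: qp].
move=> [p [q pq]] [p' [q' pq']]; rewrite /source /target /= => e.
have [ep eq] : p = p' /\ q = q'.
  have e1 : p = p' \/ p = q' by rewrite -(congr1 (fun k => k p) e); left.
  have e2 : q = p' \/ q = q' by rewrite -(congr1 (fun k => k q) e); right.
  have e3 : p' = p \/ p' = q by rewrite (congr1 (fun k => k p') e); left.
  have e4 : q' = p \/ q' = q by rewrite (congr1 (fun k => k q') e); right.
  case: e1 e2 e3 e4 => [->|e1] [e2|->] e3 e4 //.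
  - by rewrite e2 in e4 *; case: e4 => ->.
  - subst p q; split; apply: anti => //.
  - by case: e3 => [->|->]; rewrite e1.
subst p' q'; congr existT; congr existT.
exact (proof_irrelevance (forall a, sval p a -> _) _ _).
Qed.

(* A set p of arrows encodes a subgraph: its objects are those whose identity
   lies in p, its edges the members of p between such objects. *)
Definition objects_in (I : category) (p : arrow I -> Prop) : Type :=
  {t : I | p (to_arrow (ident t))}.

(** The set [p] need not be closed under composition, so compatibility is imposed edge by edge and
    no subcategory is formed. *)
Definition partial_cocone (I C : category) (X : functor I C)
  (p : arrow I -> Prop) (w : C)
  (l : forall t : objects_in p, hom (X (sval t)) w) : Prop :=
  forall (s t : objects_in p) (u : hom (sval s) (sval t)),
    p (to_arrow u) -> l t ∘ fmap X u = l s.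

Definition partial_colimit (I C : category) (X : functor I C)
  (p : arrow I -> Prop) (w : C)
  (l : forall t : objects_in p, hom (X (sval t)) w) : Prop :=
  partial_cocone l /\
  forall w' (l' : forall t : objects_in p, hom (X (sval t)) w'),
    partial_cocone l' ->
    exists! h : hom w w', forall t, h ∘ l t = l' t.

(** The piece is rewritten as a bipartite diagram: each edge of the subgraph becomes a left vertex
    carrying its source, joined to the source by an identity and to the target by its own image
    under [X]. *)
Lemma partial_colimit_compact (S : zfc) (lambda U : S) (I : category)
  (C : set_category S) (X : functor I C) (p : arrow I -> Prop) :
  regular_cardinal lambda -> universe U -> lambda ∈ U ->
  (forall J : set_category S, small U J ->
    forall Y : functor J C, has_colimit Y) ->
  (forall t, compact lambda U (X t)) ->
  bounded_subset lambda p ->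
  exists w (l : forall t : objects_in p, hom (X (sval t)) w),
    partial_colimit l /\ compact lambda U w.
Proof.
move=> hl hU lU cC kX bp.
pose R := {r : arrow I | p r /\
  (p (to_arrow (ident (source r))) /\ p (to_arrow (ident (target r))))}.
have bR : bounded lambda R.
  apply: (bounded_inj (q := fun r : R =>
    exist p (sval r) (proj1 (proj2_sig r))) hl) bp => r r'.
  by move=> /(congr1 (@sval _ _)) /=; apply: sig_eq.
have bQ : bounded lambda (objects_in p).
  apply: (bounded_inj (q := fun t : objects_in p =>
    exist p (to_arrow (ident (sval t))) (proj2_sig t)) hl) bp => t t'.
  by move=> /(congr1 (@sval _ _)) /= /ident_arrow_inj; apply: sig_eq.
have [m ml [rho rhoP]] := bounded_enumeration hl bR.
have bm := bounded_member hl ml.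
pose src (r : R) : objects_in p :=
  exist _ (source (sval r)) (proj1 (proj2 (proj2_sig r))).
pose tgt (r : R) : objects_in p :=
  exist _ (target (sval r)) (proj2 (proj2 (proj2_sig r))).
pose XP n := X (source (sval (rho n))).
pose XQ (t : objects_in p) := X (sval t).
pose end_of (e : El m * bool) := if e.2 then tgt (rho e.1) else src (rho e.1).
pose f (e : El m * bool) : hom (XP e.1) (XQ (end_of e)) :=
  match e return hom (XP e.1) (XQ (end_of e)) with
  | (n, true) => fmap X (underlying (sval (rho n)))
  | (n, false) => ident _
  end.
have bJ : bounded lambda (arrow (bipartite fst end_of)).
  exact: bounded_bipartite hl bm bQ (bounded_prod hl bm (bounded_bool hl)).
have [c cP] := small_colimit (bipartite_functor f) hl hU lU cC bJ.
have partialP w (l : forall t, hom (XQ t) w) :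
    (forall n, l (tgt (rho n)) ∘ fmap X (underlying (sval (rho n))) =
      l (src (rho n))) -> partial_cocone l.
  move=> h [s ps] [t pt] u pu.
  have := bijective_surjective rhoP
    (exist _ (to_arrow u) (conj pu (conj ps pt)) : R).
  move=> [n rn]; have := h n; rewrite rn /src /tgt /=.
  by rewrite (proof_irrelevance _ (proj1 _) ps)
    (proof_irrelevance _ (proj2 _) pt).
exists (apex c), (fun t => leg c (inr t)); split; last first.
  by apply: colimit_compact hl bJ _ cP => -[n|t]; apply: kX.
split.
  apply: partialP => n.
  rewrite [LHS](bipartite_leg c (n, true)) -(bipartite_leg c (n, false)).
  exact: compose_idr.
move=> w l lP.
have e_nat (e : El m * bool) : l (end_of e) ∘ f e = l (src (rho e.1)).
  case: e => n []; last exact: compose_idr.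
  have pr : p (to_arrow (underlying (sval (rho n)))).
    by case: (rho n) => -[a [b g]] [].
  exact: lP (src (rho n)) (tgt (rho n)) _ pr.
have dn := @bipartite_cocone _ _ _ _ _ _ XP XQ f w
  (fun n => l (src (rho n))) l e_nat.
have [h hP] := colimit_factor (Cocone dn) cP.
exists h; split=> [t|k kP]; first exact: hP (inr t).
apply: colimit_eq cP _ => -[n|t].
  rewrite -(bipartite_leg c (n, false)) !compose_assoc.
  congr (_ ∘ _).
  by rewrite (hP (inr (src (rho n)))) kP.
by rewrite (hP (inr t)) kP.
Qed.

(* The colimit of X is the colimit, over the filtered poset of bounded sets
   of arrows, of the colimits of the corresponding pieces of X. *)
Lemma colimit_decomposition (S : zfc) (lambda U : S) (I : category)
  (C : set_category S) (X : functor I C) (c : cocone X) :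
  regular_cardinal lambda -> universe U -> lambda ∈ U ->
  (forall J : set_category S, small U J ->
    forall Y : functor J C, has_colimit Y) ->
  (forall t, compact lambda U (X t)) -> is_colimit c ->
  exists (Y : functor (bounded_subsets lambda (arrow I)) C) (d : cocone Y),
    [/\ forall p, compact lambda U (Y p), is_colimit d & apex d = apex c].
Proof.
move=> hl hU lU cC kX cP.
pose P := bounded_subsets lambda (arrow I).
have [w] := dependent_choice_on (fun p : P =>
  partial_colimit_compact hl hU lU cC kX (proj2_sig p)).
move=> /dependent_choice_on [l lP].
have l_eq (p : P) w' (g h : hom (w p) w') :
    (forall t, g ∘ l p t = h ∘ l p t) -> g = h.
  move=> gh; have [[ln lu] _] := lP p.
  have hn : partial_cocone (fun t => h ∘ l p t).
    by move=> s t u pu; rewrite -compose_assoc ln.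
  have [k [_ uk]] := lu _ _ hn.
  by rewrite -(uk g) // -(uk h).
(* The equation is stated for all membership proofs [st] and [tt], so that later steps can use
   whichever proofs occur. *)
have [h hP] : exists h : forall r : arrow P, hom (w (source r)) (w (target r)),
    forall r t st tt, h r ∘ l (source r) (exist _ t st) =
      l (target r) (exist _ t tt).
  apply: (@dependent_choice_on (arrow P)
    (fun r => hom (w (source r)) (w (target r)))
    (fun r h => forall t st tt, h ∘ l (source r) (exist _ t st) =
      l (target r) (exist _ t tt))) => -[p [q pq]] /=.
  have [[qn _] _] := lP q; have [[_ pu] _] := lP p.
  pose wid (t : objects_in (sval p)) : objects_in (sval q) :=
    exist _ (sval t) (pq _ (proj2_sig t)).
  have n : partial_cocone (fun t => l q (wid t) : hom (X (sval t)) _).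
    by move=> s t u su; apply: (qn (wid s) (wid t)); apply: (pq _ su).
  have [h [hP _]] := pu _ _ n.
  exists h => t st tt; rewrite (proof_irrelevance _ tt (pq _ st)).
  exact: hP (exist _ t st).
pose Yhom (p q : P) (pq : hom p q) : hom (w p) (w q) := h (to_arrow pq).
have Yid p : Yhom p p (ident p) = ident (w p).
  apply: l_eq => -[t pt]; rewrite compose_idl.
  exact: (hP (to_arrow (ident p)) t pt pt).
have Ycomp p q r (g : hom q r) (f : hom p q) :
    Yhom p r (g ∘ f) = Yhom q r g ∘ Yhom p q f.
  apply: l_eq => -[t pt]; rewrite -compose_assoc.
  rewrite (hP (to_arrow f) t pt (f _ pt)).
  rewrite (hP (to_arrow g) t (f _ pt) (g _ (f _ pt))).
  exact: (hP (to_arrow (g ∘ f)) t pt (g _ (f _ pt))).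
pose Y := @Functor P C w Yhom Yid Ycomp.
have [g gP] : exists g : forall p : P, hom (w p) (apex c),
    forall p t, g p ∘ l p t = leg c (sval t).
  apply: (@dependent_choice_on P (fun p => hom (w p) (apex c))
    (fun p g => forall t, g ∘ l p t = leg c (sval t))) => p.
  have [[_ pu] _] := lP p.
  have n : partial_cocone (fun t : objects_in (sval p) => leg c (sval t)).
    by move=> s t u _; apply: leg_nat.
  by have [k [kP _]] := pu _ _ n; exists k.
have gn p q (u : hom p q) : g q ∘ fmap Y u = g p.
  apply: l_eq => -[t pt]; rewrite -compose_assoc.
  rewrite (hP (to_arrow u) t pt (u _ pt)) (gP p (exist _ t pt)).
  exact: gP q (exist _ t (u _ pt)).
exists Y, (@Cocone P C Y (apex c) g gn); split=> // [p|d].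
  exact: (proj2 (lP p)).
have bs (t : I) := bounded_singleton (x := to_arrow (ident t)) hl.
pose single t : P := exist _ _ (bs t).
have single_le t (p : P) (pt : sval p (to_arrow (ident t))) :
    hom (single t) p.
  by move=> a /= ->.
(* A cocone on the pieces yields one on [X]: the leg at [t] comes from the piece whose only arrow is
   the identity of [t]. *)
pose k t : hom (X t) (apex d) := leg d (single t) ∘
  l (single t) (exist _ t erefl).
have kE (p : P) t pt : leg d p ∘ l p (exist _ t pt) = k t.
  rewrite /k -(leg_nat d (single_le t p pt)) -compose_assoc; congr (_ ∘ _).
  exact/esym/(hP (to_arrow (single_le t p pt)) t erefl pt).
have kn s t (u : hom s t) : k t ∘ fmap X u = k s.
  (* This set contains [u] and the identities of its endpoints, so compatibility along [u] is
     visible in a single piece. *)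
  have bp := bounded_union hl (bs s)
    (bounded_union hl (bs t) (bounded_singleton (x := to_arrow u) hl)).
  pose p : P := exist _ _ bp.
  have ps : sval p (to_arrow (ident s)) by left.
  have pt : sval p (to_arrow (ident t)) by right; left.
  have pu : sval p (to_arrow u) by right; right.
  have [[pn _] _] := lP p.
  rewrite -(kE p t pt) -(kE p s ps) -compose_assoc; congr (_ ∘ _).
  exact: pn (exist _ s ps) (exist _ t pt) u pu.
have [q qP] := colimit_factor (Cocone kn) cP.
exists q; split=> [p|q' q'P].
  apply: l_eq => -[t pt].
  by rewrite -compose_assoc gP kE; apply: qP.
apply: colimit_eq cP _ => t.
rewrite qP /= /k -q'P -compose_assoc.
by rewrite (gP (single t) (exist _ t erefl)).
Qed.

(** * The essential image of an accessible extension *)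

(** Conjugated by [phi], each [fmap Y u] has a preimage under [j]; faithfulness makes the choice of
    preimages functorial. *)
Lemma lift_functor (D E K : category) (j : functor D E) (Y : functor K E)
  (d : K -> D) (phi : forall k, hom (j (d k)) (Y k)) :
  fully_faithful j -> (forall k, is_iso (phi k)) ->
  exists (Z : functor K D) (alpha : nat_trans (functor_comp j Z) Y),
    is_nat_iso alpha.
Proof.
move=> ff iphi.
have [z zP] : exists z : forall r : arrow K,
    hom (d (source r)) (d (target r)), forall r,
    phi (target r) ∘ fmap j (z r) = fmap Y (underlying r) ∘ phi (source r).
  apply: (@dependent_choice_on (arrow K)
    (fun r => hom (d (source r)) (d (target r)))
    (fun r u => phi (target r) ∘ fmap j u =
      fmap Y (underlying r) ∘ phi (source r))) => r.
  have [u uE] := bijective_surjective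
    (bijective_postcompose (j (d (source r))) (iphi (target r)))
    (fmap Y (underlying r) ∘ phi (source r)).
  by have [v vu] := bijective_surjective (ff _ _) u; exists v; rewrite vu.
have inj a k (u v : hom a (d k)) :
    phi k ∘ fmap j u = phi k ∘ fmap j v -> u = v.
  move=> /(iso_cancel_l (iphi k)) uv.
  by have [q qK _] := ff a (d k); apply: (can_inj qK).
pose Zhom k k' (u : hom k k') : hom (d k) (d k') := z (to_arrow u).
have Zid k : Zhom k k (ident k) = ident (d k).
  apply: inj; rewrite (zP (to_arrow (ident k))) !fmap_id.
  by rewrite compose_idl compose_idr.
have Zcomp k k' k'' (v : hom k' k'') (u : hom k k') :
    Zhom k k'' (v ∘ u) = Zhom k' k'' v ∘ Zhom k k' u.
  apply: inj; rewrite (zP (to_arrow (v ∘ u))) !fmap_comp compose_assoc.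
  rewrite (zP (to_arrow v)) -!compose_assoc; congr (_ ∘ _).
  exact/esym/(zP (to_arrow u)).
pose Z := @Functor K D d Zhom Zid Zcomp.
have n k k' (u : hom k k') :
    phi k' ∘ fmap (functor_comp j Z) u = fmap Y u ∘ phi k.
  exact: zP (to_arrow u).
by exists Z, (@NatTrans _ _ (functor_comp j Z) Y phi n).
Qed.

(** Lift the diagram to [D], take the colimit there, and compare its image under [j] with [c]. *)
Lemma essential_image_filtered_colimit (S : zfc) (lambda U : S)
  (D E : category) (j : functor D E) (K : set_category S) (Y : functor K E)
  (c : cocone Y) :
  fully_faithful j -> preserves_filtered_colimits lambda U j ->
  (forall I : set_category S, small U I -> filtered lambda I ->
    forall X : functor I D, has_colimit X) ->
  small U K -> filtered lambda K -> is_colimit c ->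
  (forall k, exists d (f : hom (j d) (Y k)), is_iso f) ->
  exists d (f : hom (j d) (apex c)), is_iso f.
Proof.
move=> ff pj cD sK fK cP /dependent_choice_on [d].
move=> /dependent_choice_on [phi phiP].
have [Z [alpha aP]] := lift_functor ff phiP.
have [b bP] := cD K sK fK Z.
have n s t (u : hom s t) :
    leg c t ∘ alpha t ∘ fmap (functor_comp j Z) u = leg c s ∘ alpha s.
  by rewrite -compose_assoc naturality compose_assoc leg_nat.
have bP' := pj K sK fK Z b bP.
have [h hP] := colimit_factor (Cocone n) bP'.
exists (apex b), h.
exact: (@colimit_comparison _ _ _ _ alpha (map_cocone j b) c h).
Qed.

Lemma essential_image_colimit (S : zfc) (lambda U Up : S)
  (D Dp : set_category S) (j : functor D Dp) (I : set_category S)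
  (X : functor I Dp) (c : cocone X) :
  regular_cardinal lambda -> lambda ∈ U ->
  universe U -> universe Up -> U ∈ Up ->
  locally_presentable_category lambda Up Dp ->
  fully_faithful j -> accessible_extension lambda U Up j ->
  small U I -> (forall t, compact lambda Up (X t)) -> is_colimit c ->
  exists d (f : hom (j d) (apex c)), is_iso f.
Proof.
move=> hl lU hU hUp UUp [_ cDp] ff [[_ pj] [_ cD _] _ [jk [_ es]]] sI kX cP.
have lUp : lambda ∈ Up by case: (hUp) => -[tr _ _ _] _; apply: tr UUp.
have [Y [d [kY dP <-]]] := colimit_decomposition hl hUp lUp cDp kX cP.
(* The pieces were formed in the [Up]-category [Dp], but their indexing poset is modelled in [U],
   since [j] is only known to preserve [U]-small filtered colimits. *)
have [K sK [T [Tff Tos]]] := small_model hU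
  (bounded_subsets_small lambda hU (small_arrow sI)).
have fK : filtered lambda K.
  by apply: (filtered_model Tff Tos) => J Jl Z; apply: bounded_subsets_filtered.
apply: (essential_image_filtered_colimit ff pj cD sK fK
  (restrict_colimit Tff Tos dP)) => k.
have [[a ka] [f [g fg]]] := es (exist _ (Y (T k)) (kY _)).
by exists a, f, g.
Qed.

(** * The two Beck-Chevalley conditions *)

(** As [x] is isomorphic to [j a], the inverse of [phi] extends along [f], which gives a left
    inverse of [f]. Uniqueness of extensions into [j b] makes it a right inverse. *)
Lemma iso_of_image_bijections (D E : category) (j : functor D E)
  (a b d : D) (x : E) (f : hom x (j b)) (phi : hom (j a) x) :
  is_iso phi ->
  (forall d, bijective (fun g : hom (j b) (j d) => g ∘ f)) ->
  is_iso f.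
Proof.
move=> [phi' [p'p pp']] bf.
have [h hE] := bijective_surjective (bf a) phi'.
have gf : phi ∘ h ∘ f = ident x by rewrite -compose_assoc hE.
exists (phi ∘ h); split=> //.
have [q qK _] := bf b; apply: (can_inj qK); cbv beta.
by rewrite -compose_assoc gf compose_idl compose_idr.
Qed.

Theorem theorem3p10 (S : zfc) (U Up kappa lambda : S)
  (hU : universe U) (hUp : universe Up) (hUUp : U ∈ Up)
  (hkappa : regular_cardinal kappa) (hkappaU : kappa ∈ U)
  (hlambda : regular_cardinal lambda) (hlambdaU : lambda ∈ U)
  (hkl : kappa ⊆ lambda)
  (C D Cp Dp : set_category S)
  (hC : locally_presentable_category kappa U C)
  (hD : locally_presentable_category lambda U D)
  (hCp : locally_presentable_category kappa Up Cp)
  (hDp : locally_presentable_category lambda Up Dp)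
  (i : functor C Cp) (hi : accessible_extension kappa U Up i)
  (j : functor D Dp) (hj : fully_faithful j) :
  (forall (G : functor D C) (Gp : functor Dp Cp)
     (e : functor_comp i G = functor_comp Gp j),
     accessible_functor lambda U G ->
     accessible_functor lambda Up Gp ->
     accessible_extension lambda U Up j ->
     forall (F : functor C D) (Fp : functor Cp Dp)
       (adj : adjunction F G) (adjp : adjunction Fp Gp),
       left_beck_chevalley adj adjp (nat_of_eq e))
  /\
  (forall (F : functor C D) (Fp : functor Cp Dp)
     (e : functor_comp j F = functor_comp Fp i)
     (G : functor D C) (Gp : functor Dp Cp)
     (adj : adjunction F G) (adjp : adjunction Fp Gp),
     right_beck_chevalley adj adjp (nat_of_eq (esym e))).
Proof.
have ffi := extension_fully_faithful hUp hUUp hi.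
split=> [G Gp e _ [_ pGp] extj F Fp adj adjp a|F Fp e G Gp adj adjp d].
  have [[_ pi] accC _ [ik _]] := hi.
  (* So far the mate is seen to be invertible only by maps into objects [j d]. *)
  have bij d := left_mate_bijective adj adjp (nat_of_eq_iso e)
    (ffi a (G d)) (hj (F a) d).
  have [I [sI fI [X [c [kX cP ca]]]]] := colimit_of_compacts accC a.
  have cP' := left_adjoint_colimit adjp (pi I sI fI X c cP).
  (* [Fp] preserves [lambda]-compactness because [Gp] is accessible; this is where [kappa]-compact
     objects are regarded as [lambda]-compact. *)
  have kX' t : compact lambda Up (Fp (i (X t))).
    apply: (left_adjoint_compact adjp pGp).
    exact: compact_le hkl (ik _ (kX t)).
  have [d [phi phiP]] := essential_image_colimit
    (X := functor_comp Fp (functor_comp i X))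
    hlambda hlambdaU hU hUp hUUp hDp hj extj sI kX' cP'.
  subst a; exact: iso_of_image_bijections phiP bij.
have [_ _ accCp [ik [_ es]]] := hi.
(* It suffices to test on [kappa]-compact objects of [Cp], each isomorphic to some [i c]. *)
apply: (compact_detect_iso accCp) => x kx.
have [[c kc] fP] := es (exist _ x kx).
have [f [f' [ff' f'f]]] : exists (f : hom (i c) x) (f' : hom x (i c)),
  f' ∘ f = ident (i c) /\ f ∘ f' = ident x := fP.
have bij := right_mate_bijective adj adjp (nat_of_eq_iso (esym e))
  (ffi c (G d)) (hj (F c) d).
have fi : is_iso f by exists f'.
have f'i : is_iso f' by exists f.
(* Composition with the mate on maps out of [x] is its counterpart for [i c], conjugated by
   precomposition with [f] and [f']. *)
apply: (eq_bij (bij_comp (bijective_precompose _ f'i)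
  (bij_comp bij (bijective_precompose _ fi)))) => h.
set theta := right_mate _ _ _ d.
change (theta ∘ (h ∘ f) ∘ f' = theta ∘ h).
by rewrite -!compose_assoc f'f compose_idr.
Qed.
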